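(* Fix an integer $p\ge3$ and suppose $(\beta,h)\in\Theta=[0,\infty)\times\mathbb{R}$ is $p$-special. Assume $\beta$ is known and $\boldsymbol\sigma\sim\mathbb{P}_{\beta,h,p}$. Let $m_*=m_*(\beta,h,p)$ be the unique global maximizer of $H=H_{\beta,h,p}$, and let $\hat h_N$ be the maximum likelihood estimate of $h$ based on $\boldsymbol\sigma$. Then, as $N\to\infty$, $$N^{3/4}(\hat h_N-h)\xrightarrow{D}G_1,$$ where the distribution function of $G_1$ is $$G_1(t)=F_{0,0}\left(\int_{-\infty}^\infty u\,\mathrm dF_{0,t}(u)\right),$$ and, for $\bar\beta,\bar h\in\mathbb{R}$, $F_{\bar\beta,\bar h}$ is the probability distribution (function) on $\mathbb{R}$ with Lebesgue density proportional to $\exp\left(\frac{H^{(4)}(m_* )}{24}x^4+(\bar\beta p m_*^{p-1}+\bar h)x\right)$.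
   Context: The $p$-spin Curie-Weiss model is the probability measure on $\{-1,1\}^N$ given by $\mathbb{P}_{\beta,h,p}(\boldsymbol\sigma)=\frac{1}{2^NZ_N(\beta,h,p)}\exp\{N(\beta\overline\sigma_N^p+h\overline\sigma_N)\}$, where $\overline\sigma_N=\frac1N\sum_{i=1}^N\sigma_i$ and $Z_N$ is the normalizing constant; expectation is $\mathbb{E}_{\beta,h,p}$. For fixed known $\beta$, the maximum likelihood estimate $\hat h_N\in[-\infty,\infty]$ is the solution in $h$ of $\mathbb{E}_{\beta,h,p}(\overline\sigma_N)=\overline\sigma_N$ (with value $\pm\infty$ when $\overline\sigma_N=\pm1$). Define $H_{\beta,h,p}:[-1,1]\to\mathbb{R}$ by $H_{\beta,h,p}(x)=\beta x^p+hx-I(x)$, $I(x)=\frac12\{(1+x)\log(1+x)+(1-x)\log(1-x)\}$. The point $(\beta,h)$ is $p$-special if $H_{\beta,h,p}$ has a unique global maximizer $m_*\in(-1,1)$ and $H_{\beta,h,p}''(m_* )=0$. *)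

(* Defs.v *)
From HB Require Import structures.
From mathcomp Require Import all_boot all_order all_algebra.
From mathcomp Require Import all_classical all_reals all_analysis.
From mathcomp Require Import measurable_realfun.

Set Implicit Arguments.
Unset Strict Implicit.
Unset Printing Implicit Defensive.

Import Order.TTheory GRing.Theory Num.Theory.
Import numFieldNormedType.Exports.

Local Open Scope classical_set_scope.
Local Open Scope ring_scope.

(* The space {-1, 1}^N, a spin being coded by a boolean. *)
Definition config (N : nat) := {ffun 'I_N -> bool}.

Definition spin (R : realType) (b : bool) : R := if b then 1 else - 1.

Definition mean_spin (R : realType) (N : nat) (s : config N) : R :=
  N%:R^-1 * \sum_(i < N) spin R (s i).

Definition cw_weight (R : realType) (beta h : R) (p N : nat) (s : config N) : R :=
  expR (N%:R * (beta * mean_spin R s ^+ p + h * mean_spin R s)).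

Definition cw_Z (R : realType) (beta h : R) (p N : nat) : R :=
  (2 ^+ N)^-1 * \sum_(s : config N) cw_weight beta h p s.

Definition cw_pmf (R : realType) (beta h : R) (p N : nat) (s : config N) : R :=
  cw_weight beta h p s / (2 ^+ N * cw_Z beta h p N).

Definition cw_prob (R : realType) (beta h : R) (p N : nat)
    (A : pred (config N)) : R :=
  \sum_(s : config N | A s) cw_pmf beta h p s.

Definition cw_expectation (R : realType) (beta h : R) (p N : nat)
    (X : config N -> R) : R :=
  \sum_(s : config N) cw_pmf beta h p s * X s.

Definition mle_h (R : realType) (beta : R) (p N : nat) (s : config N) : \bar R :=
  if mean_spin R s == 1 then +oo%E
  else if mean_spin R s == - 1 then -oo%E
  else (xget 0 [set h : R |
          cw_expectation beta h p (@mean_spin R N) = mean_spin R s])%:E.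

(* Only used on [-1, 1]; there 0 log 0 = 0 because ln 0 = 0. *)
Definition entropy (R : realType) (x : R) : R :=
  2^-1 * ((1 + x) * ln (1 + x) + (1 - x) * ln (1 - x)).

Definition H_fun (R : realType) (beta h : R) (p : nat) (x : R) : R :=
  beta * x ^+ p + h * x - entropy x.

Definition global_maximizer (R : realType) (beta h : R) (p : nat) (m : R) : Prop :=
  - 1 <= m <= 1 /\ forall x : R, - 1 <= x <= 1 -> H_fun beta h p x <= H_fun beta h p m.

Definition unique_global_maximizer (R : realType) (beta h : R) (p : nat) (m : R)
    : Prop :=
  global_maximizer beta h p m /\
  forall x : R, global_maximizer beta h p x -> x = m.

Definition p_special (R : realType) (beta h : R) (p : nat) : Prop :=
  exists m : R, [/\ unique_global_maximizer beta h p m, - 1 < m < 1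
                  & (H_fun beta h p)^`(2)%classic m = 0].

Definition quartic_fun (R : realType) (a b x : R) : R :=
  expR (a * x ^+ 4 + b * x).

Lemma measurable_quartic_fun (R : realType) (a b : R) :
  measurable_fun [set: R] (quartic_fun a b).
Proof.
apply: measurableT_comp => //=; apply: measurable_funD => //=.
by apply: measurable_funM => //=; apply: measurable_funX.
Qed.

Definition quartic_measure (R : realType) (a b : R)
    (A : set (measurableTypeR R)) : \bar R :=
  (\int[lebesgue_measure]_(x in A) (quartic_fun a b x)%:E)%E.

Section quartic_measure_instance.
Context (R : realType) (a b : R).

Let quartic_measure0 : quartic_measure a b set0 = 0%E.
Proof. by rewrite /quartic_measure integral_set0. Qed.

Let quartic_measure_ge0 A : (0 <= quartic_measure a b A)%E.
Proof. by apply: integral_ge0 => x _; rewrite lee_fin expR_ge0. Qed.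

Let quartic_measure_sigma_additive : semi_sigma_additive (quartic_measure a b).
Proof.
move=> A mA tA mUA; rewrite /quartic_measure/= ge0_integral_bigcup//=.
- apply: is_cvg_ereal_nneg_natsum_cond => n _ _.
  by apply: integral_ge0 => x _; rewrite lee_fin expR_ge0.
- by apply/measurable_EFinP/measurable_funTS; exact: measurable_quartic_fun.
- by move=> x _; rewrite lee_fin expR_ge0.
Qed.

HB.instance Definition _ := isMeasure.Build _ _ _ (quartic_measure a b)
  quartic_measure0 quartic_measure_ge0 quartic_measure_sigma_additive.

End quartic_measure_instance.

(* [dirac 0] is the value [mnormalize] falls back on when the total mass is    *)
(* infinite (it is never 0), that is, when the coefficient of x^4 is not < 0   *)
(* (at a p-special point it is < 0).                                           *)
Definition F_law (R : realType) (beta h : R) (p : nat) (m bbar hbar : R)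
    : probability (measurableTypeR R) R :=
  mnormalize
    (quartic_measure ((H_fun beta h p)^`(4)%classic m / 24)
                     (bbar * p%:R * m ^+ p.-1 + hbar))
    (dirac (0 : measurableTypeR R)).

Definition distribution_function (R : realType)
    (mu : probability (measurableTypeR R) R) (x : R) : R :=
  fine (mu `]-oo, x]%classic).

(* X_ N is a statistic of the model of size N with values in [-oo, +oo];       *)
(* the limit law [mu] is carried by R.                                         *)
Definition cw_cvg_distribution (R : realType) (beta h : R) (p : nat)
    (X_ : forall N : nat, config N -> \bar R)
    (mu : probability (measurableTypeR R) R) : Prop :=
  forall t : R, {for t, continuous (distribution_function mu)} ->
    cw_prob beta h p (fun s : config N => X_ N s <= t%:E)%E @[N --> \oo]
      --> distribution_function mu t.

(* Main.v *)
Require Import Defs.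
From HB Require Import structures.
From mathcomp Require Import all_boot all_order all_algebra.
From mathcomp Require Import all_classical all_reals all_analysis.
From mathcomp Require Import measurable_realfun.
From mathcomp Require Import ring lra.

Set Implicit Arguments.
Unset Strict Implicit.
Unset Printing Implicit Defensive.

Import Order.TTheory GRing.Theory Num.Theory.
Import numFieldNormedType.Exports.

Local Open Scope classical_set_scope.
Local Open Scope ring_scope.

(** Let [W = N^(1/4) (mean - m)].  Since [H'], [H''] and [H'''] vanish at [m] and
[H''''(m) < 0], [N (H (m + w N^(-1/4)) - H m)] tends to [H''''(m) w^4 / 24]; so
[W] converges to [F_(0,0)], and under the field [h + t N^(-3/4)] the mean of [W]
tends to the mean of [F_(0,t)].  As the mean magnetization is strictly increasing
in the field, the event [N^(3/4) (mle - h) <= t] is exactly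
[W <= E_(h + t N^(-3/4)) W].

No Stirling formula is needed: with [u(n) = n^n e^(-n) / n!] and [x = 2 k / N - 1],
[C(N, k) e^(N (beta x^p + h x)) = 2^N e^(N H x) u(k) u(N - k) / u(N)], and [u]
varies slowly.  As only ratios of sums matter, [u(k) u(N - k)] is compared with
its value at an index whose magnetization is near [m].  The sums over [k] are
integrals of step functions of [W], to which dominated convergence applies. *)

(** * The fourth-order maximum of H *)

(** The vanishing of [H''] at [m] is assumed; that of [H'''] follows from maximality, since an odd
    leading term changes sign. Maximality only gives [H''''(m) <= 0]; strictness is algebra: the
    equations [H'' = H''' = 0] force [H''''(m) = - 4 / (1 - m^2)^3]. Dominated convergence needs one
    bound valid for all [k]: near [m] the factor [u(k) u(N - k)] is comparable to its reference
    value, and elsewhere a crude loss of order [N^2] is absorbed by half of the quartic decay.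
    Indicators of half-lines are among the test functions, whence pointwise limits that may fail at
    one point. That [G_1] is a probability distribution function is a separate matter: the mean of
    [F_(0,t)] has to be nondecreasing, continuous and unbounded in both directions as a function of
    [t]. Monotonicity is inherited from the finite models in the limit, and unboundedness comes from
    a convexity bound on exponential tilts. *)

Section derivation_rules.
Variable R : realType.
Implicit Types f g : R -> R.

Lemma is_derive_fB f g (x a b : R) : is_derive x 1 f a -> is_derive x 1 g b ->
  is_derive x 1 (fun y => f y - g y) (a - b).
Proof. by move=> fa gb; exact: is_deriveB. Qed.

Lemma is_derive_fD f g (x a b : R) : is_derive x 1 f a -> is_derive x 1 g b ->
  is_derive x 1 (fun y => f y + g y) (a + b).
Proof. by move=> fa gb; exact: is_deriveD. Qed.

Lemma is_derive_fM f g (x a b : R) : is_derive x 1 f a -> is_derive x 1 g b ->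
  is_derive x 1 (fun y => f y * g y) (f x * b + g x * a).
Proof. by move=> fa gb; exact: is_deriveM. Qed.

Lemma is_derive_fX f (x a : R) n : is_derive x 1 f a ->
  is_derive x 1 (fun y => f y ^+ n) (n%:R * f x ^+ n.-1 * a).
Proof.
move=> fa; have := is_deriveX n fa.
suff -> : (fun y => f y ^+ n) = f ^+ n by [].
by rewrite funeqE => y; rewrite fctE.
Qed.

Lemma is_derive_fV f (x a : R) : f x != 0 -> is_derive x 1 f a ->
  is_derive x 1 (fun y => (f y)^-1) (- (f x)^-1 ^+ 2 * a).
Proof. by move=> fx fa; rewrite exprVn; exact: is_deriveV. Qed.

Lemma is_derive_fln f (x a : R) : 0 < f x -> is_derive x 1 f a ->
  is_derive x 1 (fun y => ln (f y)) ((f x)^-1 * a).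
Proof. by move=> fx fa; exact: is_derive1_comp (is_derive1_ln fx) fa. Qed.

Lemma is_derive_fid (x : R) : is_derive x 1 (fun y : R => y) 1.
Proof. exact: is_derive_id. Qed.

Lemma is_derive_fcst (x c : R) : is_derive x 1 (fun y : R => c) 0.
Proof. exact: is_derive_cst. Qed.

End derivation_rules.

(* A plain [apply] would launch a search for [is_derive] instances. *)
Ltac derive_rules :=
  simple notypeclasses refine (is_derive_eq _ _);
  [ shelve
  | repeat first [ eassumption
      | notypeclasses refine (is_derive_fid _)
      | notypeclasses refine (is_derive_fcst _ _)
      | notypeclasses refine (is_derive_fB _ _)
      | notypeclasses refine (is_derive_fD _ _)
      | notypeclasses refine (is_derive_fV _ _)
      | notypeclasses refine (is_derive_fln _ _)
      | notypeclasses refine (is_derive_fX _ _)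
      | notypeclasses refine (is_derive_fM _ _) ]
  | ].

Lemma mvt_abs (R : realType) (f df : R -> R) (m x : R) :
  (forall y, `|y - m| <= `|x - m| -> is_derive y 1 f (df y)) ->
  exists2 c, `|c - m| <= `|x - m| & f x - f m = df c * (x - m).
Proof.
move=> fd.
have cf y : `|y - m| <= `|x - m| -> {for y, continuous f}.
  by move=> /fd [? _]; apply: differentiable_continuous; exact/derivable1_diffP.
have [mx|xm] := leP m x.
  have xm0 : `|x - m| = x - m by rewrite ger0_norm// subr_ge0.
  have H y : y \in `[m, x] -> `|y - m| <= `|x - m|.
    by rewrite in_itv/= => /andP[my yx]; rewrite xm0 ger0_norm ?subr_ge0// lerB.
  have [y||c cmx ->] := @MVT_segment R f df m x mx.
  - by move=> /subset_itv_oo_cc/H/fd.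
  - by apply: continuous_in_subspaceT => y; rewrite inE => /H/cf.
  - by exists c => //; exact: H.
have xm0 : `|x - m| = m - x by rewrite ltr0_norm ?subr_lt0// opprB.
have H y : y \in `[x, m] -> `|y - m| <= `|x - m|.
  by rewrite in_itv/= => /andP[my yx]; rewrite xm0 ler0_norm ?subr_le0//
    opprB lerB.
have [y||c cmx e] := @MVT_segment R f df x m (ltW xm).
- by move=> /subset_itv_oo_cc/H/fd.
- by apply: continuous_in_subspaceT => y; rewrite inE => /H/cf.
- by exists c; [exact: H|rewrite -opprB e -mulrN opprB].
Qed.

(** Induction on [n] along the shifted family [f j.+1]: subtracting the monomial from [f 0] leaves a
    function whose derivative is the corresponding remainder of [f 1], and the mean value theorem
    gains one power of [x - m]. The base case is the continuity of the top derivative at [m]. *)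
Lemma taylor_peano (R : realType) (f : nat -> R -> R) (m r : R) (n : nat) :
  0 < r ->
  (forall j x, (j < n)%N -> `|x - m| < r -> is_derive x 1 (f j) (f j.+1 x)) ->
  {for m, continuous (f n)} ->
  (forall j, (j < n)%N -> f j m = 0) ->
  forall e : R, 0 < e -> exists2 d : R, 0 < d & forall x, `|x - m| < d ->
    `|f 0 x - f n m / n`!%:R * (x - m) ^+ n| <= e * `|x - m| ^+ n.
Proof.
move=> r0; elim: n f => [|n IH] f fd fc f0 e e0.
  have /cvgrPdist_le /(_ _ e0) /nbhs_ballP[d /= d0 H] := fc.
  exists d => // x xd; rewrite !expr0 !mulr1 divr1 distrC; apply: H.
  by rewrite /ball/= distrC.
have [d d0 H] := IH (fun j => f j.+1) (fun j x jn xr => fd j.+1 x jn xr) fc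
  (fun j jn => f0 j.+1 jn) e e0.
exists (Num.min d r); first by rewrite lt_min d0.
move=> x; rewrite lt_min => /andP[xd xr].
pose c0 := f n.+1 m / n.+1`!%:R.
pose D y := f 0%N y - c0 * (y - m) ^+ n.+1.
pose dD y := f 1%N y - f n.+1 m / n`!%:R * (y - m) ^+ n.
have [y ym|c cx] := @mvt_abs R D dD m x.
  rewrite /D /dD.
  have fy := fd 0%N y isT (le_lt_trans ym xr).
  derive_rules.
  rewrite /c0 factS natrM subr0 mulr1 mulr0 addr0 /=.
  have n0 : n.+1%:R != 0 :> R by rewrite pnatr_eq0.
  have m0 : n`!%:R != 0 :> R by rewrite pnatr_eq0 -lt0n fact_gt0.
  by move: (n.+1%:R : R) (n`!%:R : R) n0 m0 => u v u0 v0; field; rewrite u0 v0.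
rewrite {2}/D f0// subrr exprS mul0r mulr0 !subr0 /D => ->.
rewrite normrM exprSr mulrA ler_wpM2r//.
apply: (le_trans (H c (le_lt_trans cx xd))).
by rewrite ler_wpM2l ?(ltW e0)// lerXn2r// nnegrE.
Qed.

(** The falling factorial [p ^_ j] vanishes as soon as [j > p], so the truncated exponent [p - j] is
    harmless; this matters for [p = 3] at order 4. *)
Definition H_deriv (R : realType) (beta h : R) (p j : nat) (x : R) : R :=
  match j with
  | 0 => H_fun beta h p x
  | 1 => beta * p%:R * x ^+ p.-1 + h - 2^-1 * (ln (1 + x) - ln (1 - x))
  | 2 => beta * (p ^_ 2)%:R * x ^+ (p - 2) - 2^-1 * ((1 + x)^-1 + (1 - x)^-1)
  | 3 => beta * (p ^_ 3)%:R * x ^+ (p - 3)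
         - 2^-1 * (((1 - x)^-1) ^+ 2 - ((1 + x)^-1) ^+ 2)
  | _ => beta * (p ^_ 4)%:R * x ^+ (p - 4)
         - (((1 - x)^-1) ^+ 3 + ((1 + x)^-1) ^+ 3)
  end.

Lemma is_derive_ffact (R : realType) (b x : R) (p j : nat) :
  is_derive x 1 (fun x => b * (p ^_ j)%:R * x ^+ (p - j))
    (b * (p ^_ j.+1)%:R * x ^+ (p - j.+1)).
Proof.
derive_rules.
by rewrite ffactnSr natrM subnS; ring.
Qed.

Lemma is_derive_H (R : realType) (beta h x : R) (p j : nat) : (j < 4)%N ->
  -1 < x < 1 -> is_derive x 1 (H_deriv beta h p j) (H_deriv beta h p j.+1 x).
Proof.
move=> j4 /andP[x1 x2].
have p1 : 0 < 1 + x by lra.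
have p2 : 0 < 1 - x by lra.
have q1 : 1 + x != 0 by rewrite gt_eqF.
have q2 : 1 - x != 0 by rewrite gt_eqF.
case: j j4 => [|[|[|[|//]]]] _.
- have := is_derive_ffact beta x p 0.
  rewrite ffactn0 mulr1 subn0 ffactn1 subn1 => d0.
  rewrite /H_deriv /H_fun /entropy.
  derive_rules.
  by rewrite /=; field; rewrite q1 q2.
- have := is_derive_ffact beta x p 1; rewrite ffactn1 subn1 => d0.
  rewrite /H_deriv.
  derive_rules.
  by rewrite /=; field; rewrite q1 q2.
- have d0 := is_derive_ffact beta x p 2.
  rewrite /H_deriv.
  derive_rules.
  by rewrite /=; field; rewrite q1 q2.
- have d0 := is_derive_ffact beta x p 3.
  rewrite /H_deriv.
  derive_rules.
  by rewrite /=; field; rewrite q1 q2.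
Qed.

(** Continuity at 0 makes [H] continuous up to the endpoints 1 and -1, as the extreme value theorem
    will require. With [s] the square root of [x], the bound [- ln s <= s^-1] gives
    [|x ln x| <= 2 s]; for [x <= 0] the convention [ln x = 0] applies. *)
Lemma continuous_xlnx (R : realType) : continuous (fun x : R => x * ln x).
Proof.
move=> x; have [x0|x0|->] := ltgtP x 0.
- have e : \forall y \near x, (fun=> 0) y = y * ln y.
    near=> y; rewrite ln0 ?mulr0//; apply: ltW; near: y; exact: lt_nbhsl.
  apply: cvg_trans; first exact: (near_eq_cvg e).
  by rewrite ln0 ?mulr0//; [exact: cvg_cst|exact: ltW].
- by apply: cvgM; [exact: cvg_id|exact: continuous_ln].
rewrite /continuous_at mul0r; apply/cvgrPdist_le => e e0 {x}.
have d0 : 0 < Num.min 1 ((e / 2) ^+ 2).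
  by rewrite lt_min ltr01 exprn_gt0// divr_gt0.
near=> x; rewrite sub0r normrN.
have [x0|x0] := leP x 0; first by rewrite ln0// mulr0 normr0 ltW.
pose s := Num.sqrt x.
have s0 : 0 < s by rewrite sqrtr_gt0.
have xs : x = s ^+ 2 by rewrite sqr_sqrtr// ltW.
have : x < Num.min 1 ((e / 2) ^+ 2) by near: x; exact: lt_nbhsl d0.
rewrite lt_min => /andP[x1 xe].
have s1 : s < 1.
  by rewrite -(@ltr_pXn2r _ 2)// ?nnegrE ?(ltW s0)// -xs expr1n.
have se : s < e / 2.
  by rewrite -(@ltr_pXn2r _ 2)// ?nnegrE ?(ltW s0)// -?xs// divr_ge0// ltW.
have ls : - ln s <= s^-1.
  by rewrite -lnV ?posrE// ltW// ln_sublinear// invr_gt0.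
have ls0 : ln s <= 0 by rewrite ln_le0// ltW.
rewrite ler0_norm; last first.
  by apply: mulr_ge0_le0; [exact: ltW|apply: ln_le0; exact: ltW].
have -> : - (x * ln x) = s * (s * - ln s) * 2.
  by rewrite [in LHS]xs lnXn// mulr2n; ring.
have : s * (s * - ln s) <= s * 1.
  rewrite ler_pM2l// -(@divff _ s); last by rewrite gt_eqF.
  by rewrite ler_pM2l.
by lra.
Unshelve. all: by end_near. Qed.

Section landscape.
Variables (R : realType) (beta h : R) (p : nat).
Local Notation H := (H_fun beta h p).
Local Notation Hd := (H_deriv beta h p).

Lemma continuous_H : continuous H.
Proof.
move=> x; apply: cvgB.
  apply: cvgD; last by apply: cvgM; [exact: cvg_cst|exact: cvg_id].
  by apply: cvgM; [exact: cvg_cst|exact: exprn_continuous].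
apply: cvgM; first exact: cvg_cst.
apply: cvgD.
  apply: (@cvg_comp _ _ _ (fun y : R => 1 + y) (fun y => y * ln y) _ _ _ _
    (@continuous_xlnx R _)).
  by apply: cvgD; [exact: cvg_cst|exact: cvg_id].
apply: (@cvg_comp _ _ _ (fun y : R => 1 - y) (fun y => y * ln y) _ _ _ _
  (@continuous_xlnx R _)).
by apply: cvgB; [exact: cvg_cst|exact: cvg_id].
Qed.

Lemma near_itvN11 (x : R) : -1 < x < 1 -> \forall y \near x, -1 < y < 1.
Proof.
move=> x1; have /near_in_itvoo : x \in `](-1), 1[ by rewrite in_itv.
by apply: filterS => y; rewrite in_itv.
Qed.

Lemma derive1n_H (x : R) (j : nat) : (j <= 4)%N -> -1 < x < 1 ->
  H^`(j)%classic x = Hd j x.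
Proof.
elim: j x => [//|j IH] x j4 x1; rewrite derive1nS derive1E.
rewrite (@near_eq_derive _ _ _ _ (Hd j)).
  by have [_ ->] := is_derive_H beta h p j4 x1.
by apply: filterS (near_itvN11 x1) => y; apply: IH; exact: ltnW.
Qed.

Lemma continuous_H_deriv (x : R) (j : nat) : (j <= 4)%N -> -1 < x < 1 ->
  {for x, continuous (Hd j)}.
Proof.
move=> j4 x1.
have [v [dx _]] : exists v, is_derive x 1 (Hd j) v.
  move: j4; rewrite leq_eqVlt => /predU1P[->|j4]; last first.
    by eexists; exact: is_derive_H.
  have /andP[x1l x1r] := x1.
  have q1 : 1 + x != 0 by rewrite gt_eqF//; lra.
  have q2 : 1 - x != 0 by rewrite gt_eqF//; lra.
  by rewrite /H_deriv; eexists; derive_rules.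
by apply: differentiable_continuous; exact/derivable1_diffP.
Qed.

Lemma taylor_H (m : R) (n : nat) : (0 < n <= 4)%N -> -1 < m < 1 ->
  (forall j, (0 < j < n)%N -> Hd j m = 0) ->
  forall e : R, 0 < e -> exists2 d : R, 0 < d & forall x, `|x - m| < d ->
    `|H x - H m - Hd n m / n`!%:R * (x - m) ^+ n| <= e * `|x - m| ^+ n.
Proof.
move=> /andP[n0 n4] m1 H0 e e0.
(* [H] is shifted by its value at [m], so that the member of index 0 vanishes at [m] as well. *)
pose f j x := if j == 0%N then H x - H m else Hd j x.
have fn : f n = Hd n by rewrite /f gtn_eqF.
have /nbhs_ballP[r /= r0 mr] := near_itvN11 m1.
have [|||d d0 K] := @taylor_peano R f m r n r0 _ _ _ e e0.
- move=> j x jn xr; have x1 : -1 < x < 1 by apply: mr; rewrite /ball/= distrC.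
  case: j jn => [|j] jn; last exact: (is_derive_H _ _ _ (leq_trans jn n4) x1).
  rewrite /f/=.
  have d0 := is_derive_H beta h p (isT : (0 < 4)%N) x1.
  by derive_rules; rewrite subr0.
- by rewrite fn; exact: continuous_H_deriv.
- by move=> [|j] jn; [rewrite /f/= subrr|exact: H0].
by exists d => // x /K; rewrite fn.
Qed.

Hypothesis p3 : (3 <= p)%N.
Variable m : R.
Hypothesis hm : unique_global_maximizer beta h p m.
Hypothesis m1 : -1 < m < 1.
Hypothesis H2 : Hd 2 m = 0.

Lemma H_le_max (x : R) : -1 <= x <= 1 -> H x <= H m.
Proof. by case: hm => -[_ +] _ => /[apply]. Qed.

Lemma H_deriv1_max : Hd 1 m = 0.
Proof.
have m1' : m \in `](-1), 1[ by rewrite in_itv.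
have [|t|t|_ <-] := @derive1_at_max R H (-1) 1 m _ _ m1'.
- by lra.
- by rewrite in_itv/= => /(is_derive_H beta h p (isT : (0 < 4)%N))[].
- rewrite in_itv/= => /andP[t1 t2]; apply: H_le_max; lra.
by have [_ <-] := is_derive_H beta h p (isT : (0 < 4)%N) m1.
Qed.

(** If [k] were nonzero, the cubic term would be positive on the side of [m] given by the sign of
    [k], contradicting maximality. The Taylor error is taken as half the cubic coefficient
    [|k| / 6]. *)
Lemma H_deriv3_max : Hd 3 m = 0.
Proof.
apply/eqP/negPn/negP => k0; set k := Hd 3 m in k0.
have H0 j : (0 < j < 3)%N -> Hd j m = 0.
  by case: j => [|[|[|]]]// _; exact: H_deriv1_max.
have ak : 0 < `|k| by rewrite normr_gt0.
have e0 : 0 < `|k| / 12 by rewrite divr_gt0.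
have [d d0 K] := taylor_H (isT : (0 < 3 <= 4)%N) m1 H0 e0.
have /nbhs_ballP[r /= r0 mr] := near_itvN11 m1.
pose s0 := Num.min d r / 2; pose s := Num.sg k * s0.
have s00 : 0 < s0 by rewrite divr_gt0// lt_min d0.
have sd : s0 < d by rewrite /s0; have := ge_min d d r; rewrite lexx/=; lra.
have sr : s0 < r by rewrite /s0; have := ge_min r d r; rewrite lexx orbT/=; lra.
have abs_s : `|s| = s0 by rewrite /s normrM normr_sg k0 mul1r gtr0_norm.
have := K (m + s); rewrite (addrC m) addrK abs_s => /(_ sd).
have : H (s + m) <= H m.
  apply: H_le_max.
  have /andP[]: -1 < s + m < 1.
    by apply: mr; rewrite /ball/= opprD addrCA subrr addr0 normrN abs_s.
  by lra.
have -> : s ^+ 3 = Num.sg k * s0 ^+ 3.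
  by rewrite /s exprMn (exprSr (Num.sg k)) sqr_sg k0 mul1r.
have e3 : `|k| = Num.sg k * k by rewrite normrEsg.
have s3 : 0 < s0 ^+ 3 by rewrite exprn_gt0.
have : 0 < `|k| * s0 ^+ 3 by rewrite mulr_gt0.
rewrite -/k ler_norml => sk hh /andP[hh' _].
move: hh'; have -> : 3`!%:R = 6 :> R by [].
have -> : k / 6 * (Num.sg k * s0 ^+ 3) = `|k| * s0 ^+ 3 / 6 by rewrite e3; ring.
have -> : `|k| / 12 * s0 ^+ 3 = `|k| * s0 ^+ 3 / 12 by ring.
by move: sk hh; move: (`|k| * s0 ^+ 3) (H (s + m)) (H m) => u v w; lra.
Qed.

(** Let [P = p - 2] and [B = beta p (p - 1) m^(p - 2)]. The equation [H'' = 0] reads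
    [B (1 - m^2) = 1], and [m H''' = 0] then gives [P (1 - m^2) = 2 m^2], so [m] is nonzero because
    [P >= 1]. Substituting both yields [m^2 H''''(m) (1 - m^2)^3 = - 4 m^2]. *)
Lemma H_deriv4_max : Hd 4 m < 0.
Proof.
have /andP[ma mb] := m1.
have q1 : 1 + m != 0 by rewrite gt_eqF//; lra.
have q2 : 1 - m != 0 by rewrite gt_eqF//; lra.
have m2 : 0 < 1 - m ^+ 2.
  have -> : 1 - m ^+ 2 = (1 + m) * (1 - m) by ring.
  by rewrite mulr_gt0//; lra.
have m2n : 1 - m ^+ 2 != 0 by rewrite gt_eqF.
pose P : R := (p - 2)%:R.
have P1 : 1 <= P by rewrite (ler_nat _ 1) leq_subRL// ltnW.
have p23 : (p - 2 = (p - 3).+1)%N by rewrite subnSK.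
pose B := beta * (p ^_ 2)%:R * m ^+ (p - 2).
have E2 : B * (1 - m ^+ 2) = 1.
  move: H2; rewrite /H_deriv -/B => /eqP; rewrite subr_eq0 => /eqP ->.
  by field; rewrite q1 q2.
have E3 : P * B = 2^-1 * m * ((1 - m)^-1 ^+ 2 - (1 + m)^-1 ^+ 2).
  have := H_deriv3_max; rewrite /H_deriv => /eqP; rewrite subr_eq0 => /eqP e.
  rewrite (_ : 2^-1 * m * _ =
    m * (2^-1 * ((1 - m)^-1 ^+ 2 - (1 + m)^-1 ^+ 2))); last by ring.
  by rewrite -e /B (ffactnSr p 2) natrM -/P p23 exprS; ring.
have E4 : m ^+ 2 * Hd 4 m = (P - 1) * P * B
    - m ^+ 2 * ((1 - m)^-1 ^+ 3 + (1 + m)^-1 ^+ 3).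
  rewrite /H_deriv mulrBr; congr (_ - _).
  have -> : P - 1 = (p - 3)%:R by rewrite /P p23 -natr1 addrK.
  rewrite (ffactnSr p 3) (ffactnSr p 2) (natrM _ (_ * _)) natrM -/P.
  (* For [p = 3] the factor [P - 1] is zero and both terms in [beta] vanish; otherwise
     [p - 2 = (p - 4).+2] without truncation. *)
  move: p3; rewrite leq_eqVlt => /predU1P[<-|p4].
    by rewrite subnn !(mul0r, mulr0).
  rewrite /B (_ : (p - 2 = (p - 4).+2)%N); last by rewrite !subnSK// ltnW.
  by rewrite !exprS; ring.
have P2 : P * (1 - m ^+ 2) = 2 * m ^+ 2.
  have : P * B * (1 - m ^+ 2) ^+ 2 = 2 * m ^+ 2.
    by rewrite E3; field; rewrite q1 q2.
  have -> : P * B * (1 - m ^+ 2) ^+ 2 = P * (1 - m ^+ 2) * (B * (1 - m ^+ 2)).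
    by ring.
  by rewrite E2 mulr1.
have mn0 : 0 < m ^+ 2.
  have : 0 < P * (1 - m ^+ 2) by rewrite mulr_gt0//; lra.
  by rewrite P2; lra.
have : m ^+ 2 * Hd 4 m * (1 - m ^+ 2) ^+ 3 = - 4 * m ^+ 2.
  rewrite E4 mulrBl.
  have -> : (P - 1) * P * B * (1 - m ^+ 2) ^+ 3 =
     (P * (1 - m ^+ 2) - (1 - m ^+ 2)) * (P * (1 - m ^+ 2)) * (B * (1 - m ^+ 2)).
    by ring.
  by rewrite E2 P2; field; rewrite q1 q2.
move=> e; rewrite ltNge; apply/negP => H4.
have : 0 <= m ^+ 2 * Hd 4 m * (1 - m ^+ 2) ^+ 3.
  exact: mulr_ge0 (mulr_ge0 (ltW mn0) H4) (exprn_ge0 _ (ltW m2)).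
by rewrite e; lra.
Qed.

(** By compactness the maximum over [[a, b]] is attained, at a point other than [m]; uniqueness
    makes the gap strictly positive. *)
Lemma H_lt_max_off (a b : R) : -1 <= a -> b <= 1 -> m < a \/ b < m ->
  exists2 e : R, 0 < e & forall x, a <= x <= b -> H x - H m <= - e.
Proof.
move=> a1 b1 mab; have [ab|ba] := leP a b; last first.
  by exists 1 => // x /andP[ax xb]; have := le_trans ax xb; rewrite leNgt ba.
have [c cab Hc] := EVT_max ab (continuous_subspaceT continuous_H).
have {}cab : a <= c <= b by move: cab; rewrite in_itv.
have c1 : -1 <= c <= 1 by lra.
exists (H m - H c).
  rewrite subr_gt0 lt_neqAle H_le_max// andbT; apply/eqP => e.
  have : c = m by case: hm => _; apply; split => // y /H_le_max; rewrite e.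
  by case: mab; lra.
by move=> x xab; rewrite [leRHS]opprB lerD2r Hc// in_itv.
Qed.

Lemma H_quartic_bound : exists2 c : R, 0 < c &
  forall x, -1 <= x <= 1 -> H x - H m <= - c * (x - m) ^+ 4.
Proof.
have /andP[ma mb] := m1; have H4 := H_deriv4_max.
have H0 j : (0 < j < 4)%N -> Hd j m = 0.
  case: j => [|[|[|[|]]]]// _; [exact: H_deriv1_max | exact: H_deriv3_max].
have e0 : 0 < - Hd 4 m / 48 by lra.
have [d d0 K] := taylor_H (isT : (0 < 4 <= 4)%N) m1 H0 e0.
have [|||e1 e10 K1] := @H_lt_max_off (-1) (m - d); [by lra|by lra|right; lra|].
have [|||e2 e20 K2] := @H_lt_max_off (m + d) 1; [by lra|by lra|left; lra|].
(* Half of the quartic coefficient near [m]; away from it, the gaps [e1] and [e2] divided by 16,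
   which bounds [(x - m)^4] since [|x - m| <= 2]. *)
pose c := Num.min (- Hd 4 m / 48) (Num.min (e1 / 16) (e2 / 16)).
have c0 : 0 < c by rewrite !lt_min; lra.
have c1 : c <= - Hd 4 m / 48 by rewrite ge_min lexx.
have c2 : c <= e1 / 16 by rewrite !ge_min lexx orbT.
have c3 : c <= e2 / 16 by rewrite !ge_min lexx !orbT.
exists c => // x x1; have /andP[xa xb] := x1.
have y4 : 0 <= (x - m) ^+ 4 by rewrite exprn_even_ge0.
have y16 : (x - m) ^+ 4 <= 16.
  have -> : 16 = 2 ^+ 4 :> R by rewrite -natrX.
  rewrite -[leLHS]ger0_norm// normrX lerXn2r ?nnegrE// ler_norml.
  by lra.
have far e : 0 < e -> c <= e / 16 -> - e <= - c * (x - m) ^+ 4.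
  move=> ee ce; rewrite mulNr lerN2.
  by apply: (le_trans (ler_pM _ _ ce y16)) => //; lra.
have [xm|xm] := ltP `|x - m| d; last first.
  move: xm; rewrite ler_normr => /orP[xm|xm].
    by apply: (le_trans (K2 x _) (far _ _ _)) => //; lra.
  by apply: (le_trans (K1 x _) (far _ _ _)) => //; lra.
have := K x xm; rewrite -normrX (ger0_norm y4) ler_norml => /andP[_].
have -> : 4`!%:R = 24 :> R by [].
have : c * (x - m) ^+ 4 <= - Hd 4 m / 48 * (x - m) ^+ 4 by rewrite ler_wpM2r.
by move: (H x) (H m) (Hd 4 m) ((x - m) ^+ 4) => u v w y; lra.
Qed.

End landscape.

(** * Binomial weights *)

Section binomial_weight.
Variable R : realType.
Implicit Types (k l n N : nat) (q : R).

(** With [0 ^+ 0 = 1] the value at [n = 0] is 1, so that the weight identity below also covers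
    [k = 0] and [k = N]. *)
Definition stirling_ratio n : R := n%:R ^+ n / n`!%:R * expR (- n%:R).

Local Notation u := stirling_ratio.

Lemma stirling_ratio_gt0 n : 0 < u n.
Proof.
rewrite mulr_gt0 ?expR_gt0// divr_gt0 ?ltr0n ?fact_gt0//.
by case: n => [|n]; rewrite ?expr0// exprn_gt0.
Qed.

Lemma stirling_ratioS n :
  u n.+1 = n.+1%:R ^+ n / n`!%:R * expR (- n%:R) * expR (-1).
Proof.
rewrite /u factS natrM exprS -natr1 opprD expRD.
have n0 : n%:R + 1 != 0 :> R by rewrite natr1 pnatr_eq0.
have f0 : n`!%:R != 0 :> R by rewrite pnatr_eq0 -lt0n fact_gt0.
by field; rewrite f0 n0.
Qed.

(** For [n > 0] the ratio of consecutive values is [(1 + 1/n)^n / e], and [1 + 1/n <= e^(1/n)]. *)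
Lemma stirling_ratio_decr n : u n.+1 <= u n.
Proof.
rewrite stirling_ratioS mulrAC.
rewrite ler_pM2r ?expR_gt0// mulrAC ler_pM2r ?invr_gt0 ?ltr0n ?fact_gt0//.
case: n => [|n]; first by rewrite !expr0 mul1r expR_le1; lra.
rewrite expRN ler_pdivrMr ?expR_gt0//.
have n0 : n.+1%:R != 0 :> R by rewrite pnatr_eq0.
have -> : expR 1 = expR (n.+1%:R^-1) ^+ n.+1 :> R.
  by rewrite -expRM_natl mulfV.
rewrite -exprMn lerXn2r ?nnegrE ?mulr_ge0 ?expR_ge0//.
have -> : n.+2%:R = n.+1%:R * (1 + n.+1%:R^-1) :> R.
  by rewrite mulrDr mulr1 divff// natr1.
by rewrite ler_wpM2l// expR_ge1Dx.
Qed.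

(** The inverse ratio is [e (1 - 1/(n + 1))^n], at most [e^(1 - n/(n + 1)) = e^(1/(n + 1))]. *)
Lemma stirling_ratio_incr n : u n <= u n.+1 * expR (n.+1%:R^-1).
Proof.
have n0 : n.+1%:R != 0 :> R by rewrite pnatr_eq0.
have e : expR (-1) * expR n.+1%:R^-1 = expR (- n.+1%:R^-1) ^+ n :> R.
  rewrite -expRM_natl -expRD; congr expR.
  by rewrite -natr1 in n0 *; field.
rewrite stirling_ratioS -(mulrA _ (expR (-1))) e [leRHS]mulrAC.
rewrite ler_pM2r ?expR_gt0// [leRHS]mulrAC ler_pM2r ?invr_gt0 ?ltr0n ?fact_gt0//.
rewrite -exprMn lerXn2r ?nnegrE ?mulr_ge0 ?expR_ge0//.
have -> : n%:R = n.+1%:R * (1 - n.+1%:R^-1) :> R.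
  by rewrite mulrDr mulr1 mulrN divff// -natr1 addrK.
by rewrite ler_wpM2l// expR_ge1Dx.
Qed.

Lemma stirling_ratio_le1 n : u n <= 1.
Proof.
elim: n => [|n IH]; last exact: le_trans (stirling_ratio_decr n) IH.
by rewrite /u expr0 fact0 divr1 oppr0 expR0 mulr1.
Qed.

(** The previous bound is iterated with [e^(-1/(n + 1)) >= n / (n + 1)]. The true order is
    [n^(-1/2)], but any power suffices where exponential decay compensates. *)
Lemma stirling_ratio_ge n : (0 < n)%N -> expR (-1) / n%:R <= u n.
Proof.
elim: n => [//|[_ _|n /(_ isT) IH _]].
  by rewrite /u expr1 (_ : 1`! = 1)%N// !divr1 mul1r.
have := stirling_ratio_incr n.+1.
rewrite -ler_pdivrMr ?expR_gt0// -expRN; apply: le_trans.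
apply: le_trans (ler_wpM2r (expR_ge0 _) IH).
have n1 : n.+1%:R != 0 :> R by rewrite pnatr_eq0.
have n2 : n.+2%:R != 0 :> R by rewrite pnatr_eq0.
have -> : expR (-1) / n.+2%:R = expR (-1) / n.+1%:R * (1 - n.+2%:R^-1) :> R.
  rewrite -[n.+2%:R]natr1 in n2 *.
  by move: (n.+1%:R : R) n1 n2 => y n1 n2; field; rewrite n1 n2.
by rewrite ler_wpM2l ?divr_ge0 ?expR_ge0// expR_ge1Dx.
Qed.

(** If [l <= k] there is nothing to pay, as [u] decreases; if [l > k], each of the [l - k] steps
    costs a factor at most [e^(1/q)]. Hence a lower bound on [k] alone. *)
Lemma stirling_ratio_dist k l q : 0 < q -> q <= k%:R -> 
  u k <= u l * expR (`|k%:R - l%:R| / q).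
Proof.
move=> q0 qk; have [lk|kl] := leqP l k.
  apply: (@le_trans _ _ (u l)); last first.
    rewrite ler_peMr ?(ltW (stirling_ratio_gt0 _))//.
    by rewrite -[leLHS]expR0 ler_expR divr_ge0// ltW.
  elim: k lk {qk} => [|k IH]; first by rewrite leqn0 => /eqP ->.
  rewrite leq_eqVlt => /predU1P[->//|lk].
  by apply: le_trans (stirling_ratio_decr k) (IH _).
rewrite ler0_norm ?subr_le0 ?ler_nat 1?ltnW// opprB.
elim: l kl => [//|l IH]; rewrite ltnS leq_eqVlt => /predU1P[<-|kl].
  apply: (le_trans (stirling_ratio_incr k)).
  rewrite ler_wpM2l ?(ltW (stirling_ratio_gt0 _))// ler_expR -natr1 addrAC subrr add0r.
  by rewrite mul1r natr1 lef_pV2 ?posrE ?ltr0n// (le_trans qk)// ler_nat.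
apply: (le_trans (IH kl)).
apply: (le_trans (ler_wpM2r (expR_ge0 _) (stirling_ratio_incr l))).
rewrite -mulrA -expRD ler_wpM2l ?(ltW (stirling_ratio_gt0 _))// ler_expR.
have -> : (l.+1%:R - k%:R) / q = (l%:R - k%:R) / q + q^-1.
  by rewrite -natr1; ring.
rewrite [leLHS]addrC lerD2l.
by rewrite lef_pV2 ?posrE ?ltr0n// (le_trans qk)// ler_nat ltnW// ltnW.
Qed.

Definition binom_ratio N k : R := u k * u (N - k).

Lemma binom_ratio_gt0 N k : 0 < binom_ratio N k.
Proof. by rewrite mulr_gt0 ?stirling_ratio_gt0. Qed.

(** This combines [u <= 1] on the left with [u(j) >= e^(-1) / N] at [j = l] and [j = N - l] on the
    right; [l] is strictly inside so that both are positive. *)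
Lemma binom_ratio_global N k l : (0 < l < N)%N ->
  binom_ratio N k <= expR 2 * N%:R ^+ 2 * binom_ratio N l.
Proof.
move=> /andP[l0 lN].
have kl : binom_ratio N k <= 1.
  by rewrite mulr_ile1// ?stirling_ratio_le1// ltW// stirling_ratio_gt0.
apply: (le_trans kl).
have N0 : 0 < N%:R :> R by rewrite ltr0n (leq_trans _ lN).
have B j : (0 < j <= N)%N -> 1 <= expR 1 * N%:R * u j.
  move=> /andP[j0 jN]; have j0' : 0 < j%:R :> R by rewrite ltr0n.
  rewrite [leLHS](_ : 1 = expR 1 * N%:R * (expR (-1) / N%:R)); last first.
    by rewrite expRN; field; rewrite gt_eqF//= gt_eqF ?expR_gt0.
  rewrite ler_pM2l ?mulr_gt0 ?expR_gt0//.
  apply: le_trans (stirling_ratio_ge j0).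
  by rewrite ler_pM2l ?expR_gt0// lef_pV2 ?posrE// ler_nat.
have -> : expR 2 * N%:R ^+ 2 * binom_ratio N l =
   (expR 1 * N%:R * u l) * (expR 1 * N%:R * u (N - l)).
  by rewrite (_ : 2 = 1 + 1)// expRD /binom_ratio; ring.
by rewrite mulr_ege1// B// ?l0 ?(ltnW lN)// subn_gt0 lN leq_subr.
Qed.

Lemma binom_ratio_local N k l q : 0 < q -> (k <= N)%N -> (l <= N)%N ->
  q <= k%:R -> q <= (N - k)%:R ->
  binom_ratio N k <= binom_ratio N l * expR (2 * `|k%:R - l%:R| / q).
Proof.
move=> q0 kN lN qk qNk.
have -> : expR (2 * `|k%:R - l%:R| / q) =
    expR (`|k%:R - l%:R| / q) * expR (`|(N - k)%:R - (N - l)%:R| / q).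
  have -> : (N - k)%:R - (N - l)%:R = l%:R - k%:R :> R by rewrite !natrB//; ring.
  by rewrite (distrC l%:R) -expRD; congr expR; ring.
rewrite /binom_ratio [leRHS]mulrACA.
apply: ler_pM; [exact: ltW (stirling_ratio_gt0 _)..| |];
  exact: stirling_ratio_dist.
Qed.

(** The implication admits [k = 0] with [y = 0], which occurs at the magnetizations 1 and -1. *)
Lemma expR_natM_ln k (y : R) : (0 < k)%N ==> (0 < y) ->
  expR (k%:R * ln y) = y ^+ k.
Proof.
case: k => [_|k y0]; first by rewrite mul0r expR0 expr0.
by rewrite expRM_natl lnK.
Qed.

Definition mean_of N k : R := 2 * k%:R / N%:R - 1.

Lemma mean_of_itv N k : (k <= N)%N -> -1 <= mean_of N k <= 1.
Proof.
move=> kN; rewrite /mean_of lerBlDr lerBrDr addNr divr_ge0 ?mulr_ge0//=.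
have [->|N0] := posnP N; first by rewrite invr0 mulr0; lra.
by rewrite ler_pdivrMr ?ltr0n// -[1 + 1]/(2%:R) ler_wpM2l// ler_nat.
Qed.

Lemma expR_entropy N k : (0 < N)%N -> (k <= N)%N ->
  expR (N%:R * entropy (mean_of N k)) =
  2 ^+ N * (k%:R ^+ k * (N - k)%:R ^+ (N - k) / N%:R ^+ N).
Proof.
move=> N0 kN.
have N0' : N%:R != 0 :> R by rewrite pnatr_eq0 -lt0n.
have e1 : 1 + mean_of N k = 2 * k%:R / N%:R by rewrite /mean_of; ring.
have e2 : 1 - mean_of N k = 2 * (N - k)%:R / N%:R.
  by rewrite /mean_of natrB//; field.
rewrite /entropy e1 e2.
have -> : N%:R * (2^-1 * (2 * k%:R / N%:R * ln (2 * k%:R / N%:R) +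
      2 * (N - k)%:R / N%:R * ln (2 * (N - k)%:R / N%:R)))
   = k%:R * ln (2 * k%:R / N%:R) + (N - k)%:R * ln (2 * (N - k)%:R / N%:R) :> R.
  by field.
rewrite expRD !expR_natM_ln; last 2 first.
- by apply/implyP => k0; rewrite divr_gt0 ?mulr_gt0 ?ltr0n.
- by apply/implyP => k0; rewrite divr_gt0 ?mulr_gt0 ?ltr0n.
have eN (x : R) : x ^+ N = x ^+ k * x ^+ (N - k) by rewrite -exprD subnKC.
have N0k j : N%:R ^+ j != 0 :> R by rewrite expf_neq0.
rewrite !exprMn !exprVn !eN; move: (N0k k) (N0k (N - k)%N) => u0 v0.
by field; rewrite u0 v0.
Qed.

Lemma binom_weightE (beta h : R) (p N k : nat) : (0 < N)%N -> (k <= N)%N ->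
  'C(N, k)%:R * expR (N%:R * (beta * mean_of N k ^+ p + h * mean_of N k)) =
  2 ^+ N / u N * expR (N%:R * H_fun beta h p (mean_of N k)) * binom_ratio N k.
Proof.
move=> N0 kN.
have -> : beta * mean_of N k ^+ p + h * mean_of N k =
    H_fun beta h p (mean_of N k) + entropy (mean_of N k) by rewrite subrK.
rewrite mulrDr expRD expR_entropy// /binom_ratio /u.
have -> : expR (- k%:R) = expR (- N%:R) / expR (- (N - k)%:R) :> R.
  by rewrite -expRN -expRD; congr expR; rewrite natrB//; ring.
rewrite -(bin_fact kN) !natrM.
have fne j : j`!%:R != 0 :> R by rewrite pnatr_eq0 -lt0n fact_gt0.
have ene (x : R) : expR x != 0 by rewrite gt_eqF ?expR_gt0.
have N0' : N%:R ^+ N != 0 :> R by rewrite expf_neq0// pnatr_eq0 -lt0n.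
have C0 : 'C(N, k)%:R != 0 :> R by rewrite pnatr_eq0 -lt0n bin_gt0.
by field; rewrite !ene !fne C0 N0'.
Qed.

End binomial_weight.

(** * Laplace sums *)

Section scaling.
Variable R : realType.

Definition rho (N : nat) : R := N%:R `^ 4^-1.

Lemma rho_gt0 N : (0 < N)%N -> 0 < rho N.
Proof. by move=> N0; rewrite powR_gt0// ltr0n. Qed.

Lemma rho_ge0 N : 0 <= rho N.
Proof. exact: powR_ge0. Qed.

Lemma rhoX4 N : rho N ^+ 4 = N%:R.
Proof. by rewrite -powR_mulrn ?powR_ge0// -powRrM mulVf// powRr1. Qed.

Lemma rhoX3 N : rho N ^+ 3 = N%:R `^ (3 / 4).
Proof. by rewrite -powR_mulrn ?powR_ge0// -powRrM mulrC. Qed.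

Lemma cvg_rhoV : (rho N)^-1 @[N --> \oo] --> (0 : R).
Proof.
apply/cvgrPdist_le => e e0; near=> N.
have N0 : (0 < N)%N by near: N; exact: nbhs_infty_gt.
rewrite sub0r normrN ger0_norm ?invr_ge0 ?rho_ge0//.
rewrite -[leRHS]invrK lef_pV2 ?posrE ?invr_gt0 ?rho_gt0//.
rewrite -(@ler_pXn2r _ 4)// ?nnegrE ?invr_ge0 ?(ltW e0) ?rho_ge0//.
by rewrite rhoX4; near: N; exact: nbhs_infty_ger.
Unshelve. all: by end_near. Qed.

Variable m : R.
Hypothesis m1 : -1 < m < 1.

Definition scaled N k : R := rho N * (mean_of R N k - m).

(** The spacing of the values of [scaled]: [2 / N] for the magnetization, multiplied by
    [rho N = N^(1/4)]. *)
Definition mesh N : R := 2 / rho N ^+ 3.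

(** The equation [scaled N k = w] solved for [k] and rounded down: for large [N], the grid point at
    the left of [w]. At [w = 0] it is the reference index, with magnetization near [m]. *)
Definition idx N (w : R) : nat :=
  Num.truncn ((w / rho N + m + 1) * N%:R / 2).

Lemma cvg_mesh : mesh N @[N --> \oo] --> (0 : R).
Proof.
have -> : mesh = (fun N => 2 * (rho N)^-1 ^+ 3).
  by apply/funext => N; rewrite /mesh -exprVn.
rewrite [X in _ --> X](_ : 0 = 2 * 0 ^+ 3); last by rewrite expr0n mulr0.
apply: cvgM; first exact: cvg_cst.
exact: (cvg_comp _ _ cvg_rhoV (@exprn_continuous R 3 0)).
Qed.

Lemma scaledS N k : (0 < N)%N -> scaled N k.+1 = scaled N k + mesh N.
Proof.
move=> N0; have r0 : rho N != 0 by rewrite gt_eqF// rho_gt0.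
by rewrite /scaled /mean_of /mesh -(rhoX4 N) -natr1; field.
Qed.

Lemma scaled_le N k l : (0 < N)%N -> (scaled N k <= scaled N l) = (k <= l)%N.
Proof.
move=> N0; rewrite /scaled ler_pM2l ?rho_gt0// /mean_of lerD2r lerD2r.
by rewrite ler_pM2r ?invr_gt0 ?ltr0n// ler_pM2l// ler_nat.
Qed.

Lemma mean_scaled N k : (0 < N)%N -> mean_of R N k - m = scaled N k / rho N.
Proof.
by move=> N0; rewrite /scaled mulrC mulrA mulVf ?mul1r// gt_eqF// rho_gt0.
Qed.

Lemma idxP w : \forall N \near \oo, (0 < idx N w < N)%N /\
  scaled N (idx N w) <= w < scaled N (idx N w) + mesh N.
Proof.
have /andP[ma mb] := m1.
have cw : w / rho N @[N --> \oo] --> 0.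
  rewrite [X in _ --> X](_ : 0 = w * 0); last by rewrite mulr0.
  by apply: cvgM; [exact: cvg_cst|exact: cvg_rhoV].
(* The first bound keeps [w / rho N + m + 1] above [(1 + m) / 2], hence [z >= 1] once
   [N >= 4 / (1 + m)]; the second keeps it below 2, hence [z < N]. *)
have d0 : 0 < Num.min ((1 + m) / 2) (1 - m) by rewrite lt_min; lra.
near=> N.
have : `|w / rho N| < Num.min ((1 + m) / 2) (1 - m).
  by near: N; move/cvgr0Pnorm_lt : cw; apply.
rewrite lt_min => /andP[]; rewrite !ltr_norml => /andP[w1 _] /andP[_ w2].
have N4 : 4 / (1 + m) <= N%:R by near: N; exact: nbhs_infty_ger.
have N0 : (0 < N)%N by near: N; exact: nbhs_infty_gt.
have N0' : 0 < N%:R :> R by rewrite ltr0n.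
set z := (w / rho N + m + 1) * N%:R / 2.
have z1 : 1 <= z.
  have : 4 <= (1 + m) * N%:R by rewrite mulrC -ler_pdivrMr//; lra.
  have : (1 + m) / 2 * N%:R <= (w / rho N + m + 1) * N%:R.
    by rewrite ler_pM2r//; lra.
  by rewrite /z; lra.
have zN : z < N%:R.
  have : (w / rho N + m + 1) * N%:R < 2 * N%:R by rewrite ltr_pM2r//; lra.
  by rewrite /z; lra.
have /andP[t1 t2] : (idx N w)%:R <= z < (idx N w).+1%:R.
  exact: (truncn_itv (le_trans ler01 z1)).
have r0 : 0 < rho N by exact: rho_gt0.
have wz : w = rho N * (2 * z / N%:R - 1 - m).
  by rewrite /z; field; rewrite !gt_eqF.
split.
  rewrite -(@ltr_nat R (idx N w)) (le_lt_trans t1)// andbT.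
  by rewrite -ltnS -(@ltr_nat R) (le_lt_trans z1).
apply/andP; split.
  rewrite [leRHS]wz /scaled ler_pM2l// !lerD2r ler_pM2r ?invr_gt0//.
  by rewrite ler_pM2l.
rewrite -scaledS// [ltLHS]wz /scaled ltr_pM2l// !ltrD2r ltr_pM2r ?invr_gt0//.
by rewrite ltr_pM2l.
Unshelve. all: by end_near. Qed.

Lemma cvg_scaled_idx w : scaled N (idx N w) @[N --> \oo] --> w.
Proof.
apply/cvgrPdist_le => e e0; near=> N.
have [_ /andP[H1 H2]] : (0 < idx N w < N)%N /\
  scaled N (idx N w) <= w < scaled N (idx N w) + mesh N.
  by near: N; exact: idxP.
have : `|mesh N| < e by near: N; move/cvgr0Pnorm_lt : cvg_mesh; apply.
rewrite ltr_norml => /andP[_ He].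
rewrite ger0_norm; lra.
Unshelve. all: by end_near. Qed.

Lemma cvg_mean_scaled (k_ : nat -> nat) (w : R) :
  scaled N (k_ N) @[N --> \oo] --> w ->
  mean_of R N (k_ N) @[N --> \oo] --> m.
Proof.
move=> cw; have := cvgM cw cvg_rhoV; rewrite mulr0 => c0.
have : (m + (scaled N (k_ N) / rho N)) @[N --> \oo] --> m.
  by rewrite -[X in _ --> X]addr0; apply: cvgD; [exact: cvg_cst|exact: c0].
apply: cvg_trans; apply: near_eq_cvg; near=> N.
by rewrite -mean_scaled ?subrKC//; near: N; exact: nbhs_infty_gt.
Unshelve. all: by end_near. Qed.

End scaling.

Section laplace_weight.
Variables (R : realType) (beta h : R) (p : nat) (m : R).
Hypothesis p3 : (3 <= p)%N.
Hypothesis hm : unique_global_maximizer beta h p m.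
Hypothesis m1 : -1 < m < 1.
Hypothesis H2 : H_deriv beta h p 2 m = 0.

Local Notation H := (H_fun beta h p).
Local Notation x_ := (mean_of R).
Local Notation w_ := (scaled m).

Definition quartic_coef : R := H_deriv beta h p 4 m / 24.

Definition laplace_weight N k : R :=
  expR (N%:R * (H (x_ N k) - H m)) *
  (binom_ratio R N k / binom_ratio R N (idx m N 0)).

Local Notation phi := laplace_weight.

Lemma laplace_weight_ge0 N k : 0 <= phi N k.
Proof. by rewrite mulr_ge0 ?expR_ge0// divr_ge0// ltW// binom_ratio_gt0. Qed.

(** Half the distance from [m] to the endpoints: within [delta] of [m], a magnetization stays at
    distance at least [delta] from 1 and -1. *)
Let delta : R := (1 - `|m|) / 2.

Let delta_gt0 : 0 < delta.
Proof. by rewrite divr_gt0// subr_gt0 ltr_norml. Qed.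

Let delta_itv x : `|x - m| < delta -> delta <= 1 + x /\ delta <= 1 - x.
Proof.
rewrite /delta ltr_norml => /andP[]; have := ler_norm m.
by have := ler_norm (- m); rewrite normrN; split; lra.
Qed.

(** Near [m] both [k] and [N - k] are at least [q = delta N / 2], so the local comparison costs only
    the exponential of a multiple of the difference of magnetizations. *)
Let near_binom_ratio N k l : (0 < N)%N -> (k <= N)%N -> (l <= N)%N ->
  `|x_ N k - m| < delta ->
  binom_ratio R N k <= binom_ratio R N l * expR (2 / delta * `|x_ N k - x_ N l|).
Proof.
move=> N0 kN lN /delta_itv[d1 d2].
have N0' : 0 < N%:R :> R by rewrite ltr0n.
have Nn0 : N%:R != 0 :> R by rewrite gt_eqF.
have dn0 : delta != 0 by rewrite gt_eqF.
pose q := delta * N%:R / 2.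
have q0 : 0 < q by rewrite divr_gt0// mulr_gt0.
have qk : q <= k%:R.
  have -> : k%:R = (1 + x_ N k) * N%:R / 2 by rewrite /mean_of; field.
  by rewrite ler_pM2r ?invr_gt0// ler_pM2r.
have qNk : q <= (N - k)%:R.
  have -> : (N - k)%:R = (1 - x_ N k) * N%:R / 2.
    by rewrite /mean_of natrB//; field.
  by rewrite ler_pM2r ?invr_gt0// ler_pM2r.
apply: le_trans (binom_ratio_local q0 kN lN qk qNk) _.
rewrite ler_pM2l ?binom_ratio_gt0// ler_expR.
have -> : x_ N k - x_ N l = 2 / N%:R * (k%:R - l%:R) by rewrite /mean_of; ring.
rewrite normrM (ger0_norm (divr_ge0 _ (ltW N0')))// /q.
rewrite le_eqVlt; apply/orP; left; apply/eqP.
by field; rewrite dn0 Nn0.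
Qed.

(** The quartic bound on [H] gives the decay [e^(- c w^4)]. Within [delta] of [m] the ratio of
    binomial factors is bounded; beyond, it is at most a multiple of [N^2], and [b N <= c w^4 / 2]
    there, so half of the exponent absorbs it. *)
Lemma laplace_weight_bound : exists K c : R, [/\ 0 <= K, 0 < c &
  \forall N \near \oo, forall k, (k <= N)%N ->
    phi N k <= K * expR (- c * w_ N k ^+ 4)].
Proof.
have [c c0 Hc] := H_quartic_bound p3 hm m1 H2.
pose b := c * delta ^+ 4 / 2.
have b0 : 0 < b by rewrite divr_gt0// mulr_gt0// exprn_gt0.
(* [4 / delta] comes from [|x_k - x_l| <= 2], and [4 / b^2] from [(b N / 2)^2 <= e^(b N)]. *)
pose K1 : R := expR (4 / delta); pose K2 : R := expR 2 * (4 / b ^+ 2).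
have K10 : 0 <= K1 by exact: expR_ge0.
have K20 : 0 <= K2.
  by rewrite !mulr_ge0 ?expR_ge0// invr_ge0 exprn_ge0// ltW.
exists (K1 + K2), (c / 2); split; [exact: addr_ge0|exact: divr_gt0|].
near=> N => k kN.
have [lN _] : (0 < idx m N 0 < N)%N /\
  scaled m N (idx m N 0) <= 0 < scaled m N (idx m N 0) + mesh R N.
  by near: N; exact: idxP.
have N0 : (0 < N)%N by near: N; exact: nbhs_infty_gt.
have N0' : 0 < N%:R :> R by rewrite ltr0n.
have xkN := mean_of_itv R kN; have xlN := mean_of_itv R (ltnW (andP lN).2).
have w4 : w_ N k ^+ 4 = N%:R * (x_ N k - m) ^+ 4 by rewrite exprMn rhoX4.
have w40 : 0 <= w_ N k ^+ 4 by rewrite exprn_even_ge0.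
have e1 : expR (N%:R * (H (x_ N k) - H m)) <= expR (- c * w_ N k ^+ 4).
  rewrite ler_expR w4 mulrCA ler_pM2l//; exact: Hc.
have l0 := binom_ratio_gt0 R N (idx m N 0).
have [xm|xm] := ltP `|x_ N k - m| delta.
- have r1 : binom_ratio R N k / binom_ratio R N (idx m N 0) <= K1.
    rewrite ler_pdivrMr// mulrC.
    apply: le_trans (near_binom_ratio N0 kN (ltnW (andP lN).2) xm) _.
    rewrite ler_pM2l// ler_expR.
    have : `|x_ N k - x_ N (idx m N 0)| <= 2 by rewrite ler_norml; lra.
    rewrite (_ : 4 / delta = 2 / delta * 2); last by ring.
    by move=> x2; rewrite ler_pM2l// divr_gt0.
  apply: (@le_trans _ _ (expR (- (c / 2) * w_ N k ^+ 4) * K1)).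
    apply: ler_pM => //.
      by rewrite divr_ge0// ltW// binom_ratio_gt0.
    apply: (le_trans e1); rewrite ler_expR ler_wpM2r//; lra.
  by rewrite mulrC ler_wpM2r ?expR_ge0//; lra.
have r2 : binom_ratio R N k / binom_ratio R N (idx m N 0) <= K2 * expR (b * N%:R).
  rewrite ler_pdivrMr//; apply: (le_trans (binom_ratio_global R k lN)).
  rewrite ler_pM2r// /K2 -mulrA ler_pM2l ?expR_gt0//.
  have bN : 0 <= b * N%:R / 2 by rewrite divr_ge0// mulr_ge0// ltW.
  have -> : b * N%:R = b * N%:R / 2 + b * N%:R / 2 by field.
  rewrite expRD.
  have : b * N%:R / 2 <= expR (b * N%:R / 2).
    by apply: le_trans (expR_ge1Dx _); lra.
  move=> E; have := ler_pM bN bN E E.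
  move: (expR _ * expR _) => X; have bn0 : b != 0 by rewrite gt_eqF.
  have -> : b * N%:R / 2 * (b * N%:R / 2) = (4 / b ^+ 2)^-1 * N%:R ^+ 2.
    by field.
  by rewrite -ler_pdivlMl ?invr_gt0 ?divr_gt0 ?exprn_gt0// invrK.
have bw : b * N%:R <= c / 2 * w_ N k ^+ 4.
  rewrite w4 /b (_ : c * delta ^+ 4 / 2 * N%:R = c / 2 * (N%:R * delta ^+ 4)).
    rewrite ler_pM2l ?divr_gt0// ler_pM2l//.
    rewrite -[leRHS]ger0_norm ?exprn_even_ge0// normrX lerXn2r ?nnegrE//.
    exact: ltW.
  by ring.
apply: (@le_trans _ _ (expR (- c * w_ N k ^+ 4) * (K2 * expR (b * N%:R)))).
  apply: ler_pM => //.
  by rewrite divr_ge0// ltW// binom_ratio_gt0.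
rewrite mulrCA -expRD.
apply: (@le_trans _ _ (K2 * expR (- (c / 2) * w_ N k ^+ 4))).
  rewrite ler_wpM2l// ler_expR.
  by move: bw; move: (b * _) (w_ N k ^+ 4) => u v; lra.
by rewrite ler_wpM2r ?expR_ge0//; lra.
Unshelve. all: by end_near. Qed.

(** The index moves with [N], as it will be that of the cell containing a fixed point. The exponent
    converges by the Taylor expansion of order 4; the ratio of binomial factors is squeezed between
    [e^(- E N)] and [e^(E N)], where [E N] tends to 0 because both magnetizations tend to [m]. *)
Lemma laplace_weight_cvg (k_ : nat -> nat) (w : R) :
  (\forall N \near \oo, (k_ N <= N)%N) ->
  w_ N (k_ N) @[N --> \oo] --> w ->
  phi N (k_ N) @[N --> \oo] --> expR (quartic_coef * w ^+ 4).
Proof.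
move=> kN cw.
have cx := cvg_mean_scaled cw.
have cl := cvg_mean_scaled (@cvg_scaled_idx R m m1 0).
have cw4 : w_ N (k_ N) ^+ 4 @[N --> \oo] --> w ^+ 4.
  exact: (cvg_comp _ _ cw (@exprn_continuous R 4 w)).
rewrite -[X in _ --> X]mulr1; apply: cvgM.
  suff cH : N%:R * (H (x_ N (k_ N)) - H m) @[N --> \oo] --> quartic_coef * w ^+ 4.
    exact: (cvg_comp _ _ cH (@continuous_expR R (quartic_coef * w ^+ 4))).
  have : quartic_coef * w_ N (k_ N) ^+ 4 @[N --> \oo] --> quartic_coef * w ^+ 4.
    by apply: cvgM => //; exact: cvg_cst.
  move=> c1; rewrite -[X in _ --> X]addr0.
  have : N%:R * (H (x_ N (k_ N)) - H m) - quartic_coef * w_ N (k_ N) ^+ 4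
      @[N --> \oo] --> (0 : R).
    apply/cvgr0Pnorm_le => e e0.
    (* [w ^+ 4 + 1] eventually bounds the scaled fourth power, so a relative Taylor error of
       [e / (w ^+ 4 + 1)] amounts to at most [e]. *)
    have W0 : 0 < w ^+ 4 + 1 by rewrite ltr_wpDl// exprn_even_ge0.
    have H0 j : (0 < j < 4)%N -> H_deriv beta h p j m = 0.
      case: j => [|[|[|[|]]]]// _; [exact: H_deriv1_max | exact: H_deriv3_max].
    have [d d0 T] := taylor_H (isT : (0 < 4 <= 4)%N) m1 H0 (divr_gt0 e0 W0).
    near=> N.
    have N0 : (0 < N)%N by near: N; exact: nbhs_infty_gt.
    have : w_ N (k_ N) ^+ 4 < w ^+ 4 + 1.
      by near: N; move/cvgr_lt : cw4; apply; rewrite ltrDl.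
    have w4 : w_ N (k_ N) ^+ 4 = N%:R * (x_ N (k_ N) - m) ^+ 4.
      by rewrite exprMn rhoX4.
    rewrite w4 => wN.
    have xd : `|x_ N (k_ N) - m| < d.
      rewrite distrC; near: N; move/cvgrPdist_lt : cx; exact.
    have := T _ xd; rewrite -normrX [`|_ ^+ 4|]ger0_norm ?exprn_even_ge0//.
    rewrite (_ : 4`!%:R = 24)// -/quartic_coef => TT.
    rewrite mulrCA -mulrBr normrM (ger0_norm (ler0n _ _)).
    apply: (@le_trans _ _ (e / (w ^+ 4 + 1) * (N%:R * (x_ N (k_ N) - m) ^+ 4))).
      by rewrite [leRHS]mulrCA ler_wpM2l.
    rewrite mulrAC ler_pdivrMr// ler_pM2l//; exact: ltW.
  move=> c0; apply: cvg_trans (cvgD c1 c0); apply: near_eq_cvg.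
  by near=> N; rewrite fctE addrC subrK.
pose E N := 2 / delta * `|x_ N (k_ N) - x_ N (idx m N 0)|.
have cE : E N @[N --> \oo] --> (0 : R).
  rewrite [X in _ --> X](_ : 0 = 2 / delta * `|m - m|); last first.
    by rewrite subrr normr0 mulr0.
  by apply: cvgM; [exact: cvg_cst|apply: cvg_norm; exact: cvgB].
have c1 : expR (- E N) @[N --> \oo] --> (1 : R).
  rewrite -expR0 -oppr0.
  by apply: (cvg_comp _ _ (cvgN cE) (@continuous_expR R _)).
have c2 : expR (E N) @[N --> \oo] --> (1 : R).
  rewrite -expR0; exact: (cvg_comp _ _ cE (@continuous_expR R _)).
apply: (squeeze_cvgr _ c1 c2); near=> N.
have N0 : (0 < N)%N by near: N; exact: nbhs_infty_gt.
have kNN : (k_ N <= N)%N by near: N.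
have [/andP[_ /ltnW lN] _] : (0 < idx m N 0 < N)%N /\
  scaled m N (idx m N 0) <= 0 < scaled m N (idx m N 0) + mesh R N.
  by near: N; exact: idxP.
have x1 : `|x_ N (k_ N) - m| < delta.
  by rewrite distrC; near: N; move/cvgrPdist_lt : cx; exact.
have x2 : `|x_ N (idx m N 0) - m| < delta.
  by rewrite distrC; near: N; move/cvgrPdist_lt : cl; exact.
rewrite ler_pdivlMr ?binom_ratio_gt0// ler_pdivrMr ?binom_ratio_gt0//.
rewrite expRN ler_pdivrMl ?expR_gt0//; apply/andP; split.
  by rewrite mulrC; have := near_binom_ratio N0 lN kNN x2; rewrite distrC.
by rewrite mulrC; exact: near_binom_ratio.
Unshelve. all: by end_near. Qed.

End laplace_weight.

(** * Gaussian domination and sums as integrals of step functions *)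

Section dominated_by_gauss.
Variable R : realType.
Local Notation mu := (@lebesgue_measure R).

Lemma integrable_gauss_bound (f : R -> R) (K : R) :
  measurable_fun setT f -> (forall x, `|f x| <= K * expR (- x ^+ 2)) ->
  mu.-integrable setT (EFin \o f).
Proof.
move=> mf fK.
apply: (@le_integrable _ _ _ mu setT measurableT _
    (fun x => K%:E * (EFin \o gauss_fun) x)%E).
- exact/measurable_EFinP.
- move=> x _ /=; rewrite lee_fin (le_trans (fK x))//.
  by rewrite /gauss_fun ler_norm.
- by apply: integrableZl => //; exact: integrableT_gauss.
Qed.

(** The exceptional point [c] leaves room for the jump of the indicator of a half-line; it is a null
    set. *)
Lemma gauss_dominated_cvg (f_ : nat -> R -> R) (f : R -> R) (K c : R) :
  (forall n, measurable_fun setT (f_ n)) -> measurable_fun setT f ->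
  (\forall n \near \oo, forall x, `|f_ n x| <= K * expR (- x ^+ 2)) ->
  (forall x, x != c -> f_ n x @[n --> \oo] --> f x) ->
  (\int[mu]_x f_ n x)%R @[n --> \oo] --> (\int[mu]_x f x)%R.
Proof.
move=> mf_ mf [n0 _ fK] fc.
(* The domination holds only from [n0] on, hence the shift of the sequence. *)
rewrite -(cvg_shiftn n0).
have fK' n x : `|f_ (n + n0)%N x| <= K * expR (- x ^+ 2).
  by apply: fK => /=; rewrite leq_addl.
have [||||| iF _ cF] := @dominated_convergence _ _ R mu setT measurableT
  (fun n => EFin \o f_ (n + n0)%N) (EFin \o f)
  (fun x => K%:E * (EFin \o gauss_fun) x)%E.
- by move=> n; apply/measurable_EFinP; exact: mf_.
- exact/measurable_EFinP.
- exists [set c]; split => //; first exact: lebesgue_measure_set1.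
  move=> x /= nx; apply: contrapT => /eqP xc; apply: nx => _.
  apply/cvg_EFin; first exact: nearW.
  by have := fc x xc; rewrite -(cvg_shiftn n0).
- by apply: integrableZl => //; exact: integrableT_gauss.
- by apply: aeW => x n _ /=; rewrite lee_fin.
have fin : (\int[mu]_x (f x)%:E)%E \is a fin_num.
  exact: integrable_fin_num iF.
by apply: fine_cvg; rewrite fineK.
Qed.

(** Here [u] is to be the grid point of the cell containing [w]; the distance 2 covers every mesh
    below 2. *)
Lemma quartic_le_gauss (c B : R) : 0 < c -> exists2 K : R, 0 < K &
  forall u w, `|w - u| <= 2 ->
    expR (- c * u ^+ 4) * expR (B * `|u|) <= K * expR (- w ^+ 2).
Proof.
(* The constants come from [w^2 <= 2 u^2 + 8], [B |u| <= B^2 + u^2] and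
   [3 u^2 <= c u^4 + 9 / (4 c)], all by completing squares. *)
move=> c0; pose C := 9 / (4 * c) + 8 + B ^+ 2.
exists (expR C); first exact: expR_gt0.
move=> u w uw; rewrite -!expRD ler_expR.
have h1 : w ^+ 2 <= 2 * u ^+ 2 + 8.
  have : (w - u) ^+ 2 <= 4.
    rewrite -[leLHS]ger0_norm ?sqr_ge0// normrX.
    have -> : 4 = 2 ^+ 2 :> R by rewrite -natrX.
    by rewrite lerXn2r ?nnegrE.
  have := sqr_ge0 (w - 2 * u).
  by rewrite !expr2; nra.
have h2 : B * `|u| <= B ^+ 2 + u ^+ 2.
  have := sqr_ge0 (B - `|u|); rewrite sqrrB real_normK ?num_real//.
  have := sqr_ge0 B; have := sqr_ge0 u.
  by move: (u ^+ 2) (B ^+ 2) => x y; rewrite mulr2n; lra.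
have h3 : 3 * u ^+ 2 <= c * u ^+ 4 + 9 / (4 * c).
  have -> : u ^+ 4 = (u ^+ 2) ^+ 2 by rewrite -exprM.
  move: (u ^+ 2) => x; rewrite -subr_ge0.
  have -> : c * x ^+ 2 + 9 / (4 * c) - 3 * x = c * (x - 3 / (2 * c)) ^+ 2.
    by field; rewrite gt_eqF.
  by rewrite mulr_ge0 ?sqr_ge0// ltW.
by rewrite /C; lra.
Qed.

End dominated_by_gauss.

Section riemann_sum.
Variables (R : realType) (m : R).
Hypothesis m1 : -1 < m < 1.
Local Notation mu := (@lebesgue_measure R).
Local Notation w_ := (scaled m).
Implicit Types (t : nat -> R) (N : nat).

(** Half-open, so that the cells of one [N] are disjoint and at most one term of a step function is
    nonzero at each point. *)
Definition cell N k : set R := `[w_ N k, w_ N k + mesh R N[%classic.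

Definition step_fun N t (w : R) : R :=
  \sum_(k < N.+1) t k * \1_(cell N k) w.

Lemma mesh_ge0 N : 0 <= mesh R N.
Proof. by rewrite divr_ge0// exprn_ge0// rho_ge0. Qed.

Lemma measurable_step_fun N t : measurable_fun setT (step_fun N t).
Proof.
apply: measurable_sum => k; apply: measurable_funM => //.
by apply: measurable_indic; exact: measurable_itv.
Qed.

Lemma integral_step_fun N t :
  (\int[mu]_x step_fun N t x)%R = mesh R N * \sum_(k < N.+1) t k.
Proof.
have iI k : mu.-integrable setT (EFin \o \1_(cell N k)).
  exact: integrable_indic_itv.
have E k : (\int[mu]_x (t k * \1_(cell N k) x)%:E = (mesh R N * t k)%:E)%E.
  under eq_integral do rewrite EFinM.
  rewrite integralZl//; last exact: iI.
  rewrite integral_indic//; last exact: measurable_itv.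
  rewrite setIT /cell /= lebesgue_measure_itv /= lte_fin ltrDl mulrC EFinM.
  (* For [N = 0] the mesh is 0 and the cell is empty. *)
  rewrite lt_neqAle mesh_ge0 andbT; case: eqP => [<-//|_] /=.
  by rewrite -EFinD addrAC subrr add0r.
rewrite /Rintegral /step_fun.
under eq_integral do rewrite -sumEFin.
rewrite integral_sum//=; last first.
  by move=> k; exact: (integrableZl measurableT (t k) (iI k)).
by under eq_bigr do rewrite E; rewrite sumEFin mulr_sumr.
Qed.


Lemma step_funE N t k w : (0 < N)%N -> (k <= N)%N -> cell N k w ->
  step_fun N t w = t k.
Proof.
move=> N0 kN ckw; rewrite /step_fun.
rewrite (bigD1 (Ordinal (kN : (k < N.+1)%N)))//= indicE mem_set// mulr1.
rewrite big1 ?addr0// => j /eqP jk; rewrite indicE memNset ?mulr0// => cjw.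
apply: jk; apply/val_inj => /=; move: ckw cjw.
rewrite /cell /= !in_itv/= -!scaledS// => /andP[k1 k2] /andP[j1 j2].
apply/eqP; rewrite eqn_leq -ltnS -(ltnS k).
have H i l : w_ N i <= w -> w < w_ N l.+1 -> (i < l.+1)%N.
  move=> iw wl; rewrite ltnNge -(scaled_le m _ _ N0) -ltNge.
  exact: le_lt_trans iw wl.
by rewrite !H.
Qed.

Lemma step_fun_off N t w : (forall k, (k <= N)%N -> ~ cell N k w) ->
  step_fun N t w = 0.
Proof.
move=> nc; rewrite /step_fun big1// => k _; rewrite indicE memNset ?mulr0//.
by apply: nc; rewrite -ltnS.
Qed.

End riemann_sum.

Section laplace_sum.
Variables (R : realType) (beta h : R) (p : nat) (m : R).
Hypothesis p3 : (3 <= p)%N.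
Hypothesis hm : unique_global_maximizer beta h p m.
Hypothesis m1 : -1 < m < 1.
Hypothesis H2 : H_deriv beta h p 2 m = 0.
Local Notation mu := (@lebesgue_measure R).
Local Notation phi := (laplace_weight beta h p m).
Local Notation a := (quartic_coef beta h p m).
Local Notation w_ := (scaled m).

Definition laplace_sum N (g : R -> R) : R :=
  \sum_(k < N.+1) phi N k * g (w_ N k).

(** The step function at [w] samples [g_ N] at the left end of the cell of [w], so convergence is
    asked along every sequence tending to [w], save at one point. The growth [e^(B |u|)]
    accommodates exponential tilts and is beaten by the quartic decay. *)
Lemma laplace_sum_cvg (g_ : nat -> R -> R) (g : R -> R) (B c : R) :
  measurable_fun setT g ->
  (forall N u, `|g_ N u| <= expR (B * `|u|)) ->
  (forall w (u_ : nat -> R), w != c -> u_ N @[N --> \oo] --> w ->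
     g_ N (u_ N) @[N --> \oo] --> g w) ->
  mesh R N * laplace_sum N (g_ N) @[N --> \oo] -->
  (\int[mu]_x (quartic_fun a 0 x * g x))%R.
Proof.
move=> mg gB gc.
have [K [b [K0 b0 Kb]]] := laplace_weight_bound p3 hm m1 H2.
have [K' K'0 HK'] := quartic_le_gauss B b0.
pose t N k := phi N k * g_ N (w_ N k).
under eq_fun do rewrite -(integral_step_fun m _ (t _)).
apply: (@gauss_dominated_cvg R (fun N => step_fun m N (t N)) _ (K * K') c).
- by move=> N; exact: measurable_step_fun.
- by apply: measurable_funM => //; exact: measurable_quartic_fun.
- near=> N => x.
  have N0 : (0 < N)%N by near: N; exact: nbhs_infty_gt.
  have [[k [kN ckx]]|nk] := pselect (exists k, (k <= N)%N /\ cell m N k x).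
    rewrite (step_funE _ N0 kN ckx) normrM (ger0_norm (laplace_weight_ge0 _ _ _ _ _ _)).
    have PK : phi N k <= K * expR (- b * w_ N k ^+ 4).
      by move: k kN {ckx}; near: N.
    apply: (@le_trans _ _ (K * expR (- b * w_ N k ^+ 4) * expR (B * `|w_ N k|))).
      by apply: ler_pM => //; exact: laplace_weight_ge0.
    rewrite -2!mulrA ler_wpM2l// HK'//.
    move: ckx; rewrite /cell/= in_itv/= => /andP[wk1 wk2].
    have : `|mesh R N| < 2 by near: N; move/cvgr0Pnorm_lt : (@cvg_mesh R); apply.
    by rewrite ltr_norml => /andP[_ mesh2]; rewrite ger0_norm; lra.
  rewrite step_fun_off ?normr0 ?mulr_ge0 ?expR_ge0// ?(ltW K'0)// => k kN ck.
  by apply: nk; exists k.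
move=> w wc; have cw := @cvg_scaled_idx R m m1 w.
have kN : \forall N \near \oo, (idx m N w <= N)%N.
  by near=> N; have [/andP[_ /ltnW]] : (0 < idx m N w < N)%N /\
    w_ N (idx m N w) <= w < w_ N (idx m N w) + mesh R N by near: N; exact: idxP.
have cphi := laplace_weight_cvg hm m1 H2 kN cw.
have : t N (idx m N w) @[N --> \oo] --> quartic_fun a 0 w * g w.
  rewrite /quartic_fun mul0r addr0; apply: cvgM => //.
  exact: (gc w (fun N => w_ N (idx m N w)) wc cw).
apply: cvg_trans; apply: near_eq_cvg; near=> N.
have N0 : (0 < N)%N by near: N; exact: nbhs_infty_gt.
have [/andP[_ /ltnW lN] cN] : (0 < idx m N w < N)%N /\
    w_ N (idx m N w) <= w < w_ N (idx m N w) + mesh R N by near: N; exact: idxP.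
by rewrite (@step_funE _ _ _ _ (idx m N w))//= in_itv.
Unshelve. all: by end_near. Qed.

End laplace_sum.

Section quartic_integrals.
Variables (R : realType) (a : R).
Hypothesis a0 : a < 0.
Local Notation mu := (@lebesgue_measure R).

Lemma quartic_gauss_bound (B : R) : exists2 K : R, 0 < K &
  forall (g : R -> R) w, `|g w| <= expR (B * `|w|) ->
    `|quartic_fun a 0 w * g w| <= K * expR (- w ^+ 2).
Proof.
have na : 0 < - a by rewrite oppr_gt0.
have [K K0 HK] := quartic_le_gauss B na.
exists K => // g w gB; rewrite normrM ger0_norm ?expR_ge0//.
have := HK w w; rewrite subrr normr0 opprK => /(_ (ler0n _ 2)).
apply: le_trans.
by rewrite /quartic_fun mul0r addr0 ler_wpM2l ?expR_ge0.
Qed.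

Lemma quartic_integrable (g : R -> R) (B : R) : measurable_fun setT g ->
  (forall w, `|g w| <= expR (B * `|w|)) ->
  mu.-integrable setT (EFin \o (fun w => quartic_fun a 0 w * g w)).
Proof.
move=> mg gB; have [K _ HK] := quartic_gauss_bound B.
apply: (@integrable_gauss_bound _ _ K); last by move=> x; exact: HK.
by apply: measurable_funM => //; exact: measurable_quartic_fun.
Qed.

Lemma quartic_integral_cvg (g_ : nat -> R -> R) (g : R -> R) (B c : R) :
  (forall n, measurable_fun setT (g_ n)) -> measurable_fun setT g ->
  (\forall n \near \oo, forall u, `|g_ n u| <= expR (B * `|u|)) ->
  (forall w, w != c -> g_ n w @[n --> \oo] --> g w) ->
  (\int[mu]_x (quartic_fun a 0 x * g_ n x))%R @[n --> \oo] -->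
  (\int[mu]_x (quartic_fun a 0 x * g x))%R.
Proof.
move=> mg_ mg gB gc; have [K _ HK] := quartic_gauss_bound B.
apply: (@gauss_dominated_cvg R _ _ K c).
- by move=> n; apply: measurable_funM => //; exact: measurable_quartic_fun.
- by apply: measurable_funM => //; exact: measurable_quartic_fun.
- by apply: filterS gB => n gB x; exact: HK.
- by move=> x /gc; apply: cvgM; exact: cvg_cst.
Qed.

End quartic_integrals.

(** * The magnetization and the estimator *)

Section configurations.
Variable R : realType.
Local Notation mean := (@mean_spin R _).

Definition plus_spins N (s : config N) : {set 'I_N} := [set i | s i]%SET.

Lemma card_plus_spins N k :
  #|[set s : config N | #|plus_spins s| == k]%SET| = 'C(N, k).
Proof.
rewrite -[in RHS](card_ord N) -card_draws.
pose F (A : {set 'I_N}) : config N := [ffun i => i \in A].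
have FK : cancel F (@plus_spins N).
  by move=> A; apply/setP => i; rewrite inE ffunE.
rewrite -(card_imset _ (can_inj FK)); apply: eq_card => s; rewrite inE.
apply/idP/imsetP => [sk|[A + ->]]; last by rewrite FK inE.
exists (plus_spins s); first by rewrite inE.
by apply/ffunP => i; rewrite ffunE inE.
Qed.

Lemma mean_spinE N (s : config N) : (0 < N)%N ->
  mean s = mean_of R N #|plus_spins s|.
Proof.
move=> N0; have N0' : N%:R != 0 :> R by rewrite pnatr_eq0 -lt0n.
rewrite /mean_spin /mean_of.
have -> : \sum_(i < N) spin R (s i) = 2 * #|plus_spins s|%:R - N%:R.
  have -> : N%:R = \sum_(i < N) 1 :> R by rewrite sumr_const card_ord.
  have -> : #|plus_spins s|%:R = \sum_(i < N) (s i)%:R :> R.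
    rewrite -sum1_card natr_sum big_mkcond/=; apply: eq_bigr => i _.
    by rewrite inE; case: (s i).
  rewrite mulr_sumr -sumrB; apply: eq_bigr => i _.
  by rewrite /spin; case: (s i) => /=; ring.
by field.
Qed.

Lemma mean_spin_itv N (s : config N) : (0 < N)%N -> -1 <= mean s <= 1.
Proof.
move=> N0; rewrite mean_spinE//; apply: mean_of_itv.
by rewrite -[leqRHS]card_ord max_card.
Qed.

Lemma sum_config N (G : R -> R) : (0 < N)%N ->
  \sum_(s : config N) G (mean s) =
  \sum_(k < N.+1) 'C(N, k)%:R * G (mean_of R N k).
Proof.
move=> N0; pose n (s : config N) : 'I_N.+1 := inord #|plus_spins s|.
have nE s : n s = #|plus_spins s| :> nat.
  by rewrite inordK// ltnS -[leqRHS]card_ord max_card.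
rewrite (partition_big n predT)//=; apply: eq_bigr => k _.
rewrite (eq_bigr (fun=> G (mean_of R N k))); last first.
  by move=> s /eqP <-; rewrite mean_spinE// nE.
rewrite (eq_bigl (mem [set s : config N | #|plus_spins s| == k]%SET)); last first.
  by move=> s; rewrite -val_eqE /= nE inE.
by rewrite sumr_const card_plus_spins mulr_natl.
Qed.

Definition const_config N (b : bool) : config N := [ffun=> b].

Lemma mean_const_config N b : (0 < N)%N -> mean (const_config N b) = spin R b.
Proof.
move=> N0; rewrite /mean_spin (eq_bigr (fun=> spin R b)); last first.
  by move=> i _; rewrite ffunE.
by rewrite sumr_const card_ord -(mulr_natl (spin R b)) mulrA mulVf ?mul1r// pnatr_eq0 -lt0n.
Qed.

End configurations.

(** * Monotonicity and range of the mean magnetization *)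

Section magnetization.
Variables (R : realType) (beta : R) (p N : nat).
Hypothesis N0 : (0 < N)%N.
Implicit Types (s : config N) (h x t : R).
Local Notation mean := (@mean_spin R N).
Local Notation weight h := (@cw_weight R beta h p N).

Definition cw_mean h : R := cw_expectation beta h p mean.

Lemma cw_weight_gt0 h s : 0 < weight h s. Proof. exact: expR_gt0. Qed.

Lemma sum_cw_weight_gt0 h : 0 < \sum_s weight h s.
Proof.
rewrite (bigD1 (const_config N true))//= ltr_pwDl ?cw_weight_gt0//.
by apply: sumr_ge0 => s _; exact: ltW (cw_weight_gt0 _ _).
Qed.

Lemma cw_pmfE h s : cw_pmf beta h p s = weight h s / \sum_s weight h s.
Proof. by rewrite /cw_pmf /cw_Z mulVKf// expf_neq0. Qed.

Lemma cw_expectationE h (X : config N -> R) :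
  cw_expectation beta h p X = (\sum_s weight h s * X s) / \sum_s weight h s.
Proof.
by rewrite mulr_suml; apply: eq_bigr => s _; rewrite cw_pmfE mulrAC.
Qed.

Lemma cw_probE h (A : pred (config N)) :
  cw_prob beta h p A = (\sum_s weight h s * (A s)%:R) / \sum_s weight h s.
Proof.
rewrite mulr_suml /cw_prob big_mkcond; apply: eq_bigr => s _.
by rewrite cw_pmfE; case: (A s); rewrite ?mulr1// mulr0 mul0r.
Qed.

(* The tilted sum [\sum_s weight 0 s * (mean s - x) * e^(N t (mean s - x))] has
   the sign of [cw_mean t - x], and each of its terms is monotone in [t]. *)
Definition tilt x t : R := \sum_s weight 0 s *
  ((mean s - x) * expR (t * (N%:R * (mean s - x)))).

Lemma cw_weight_tilt x t s :
  weight t s = weight 0 s * expR (t * (N%:R * (mean s - x))) * expR (t * (N%:R * x)).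
Proof. by rewrite /cw_weight -!expRD; congr expR; ring. Qed.

Lemma cw_mean_tilt x t : cw_mean t - x =
  tilt x t * (expR (t * (N%:R * x)) / \sum_s weight t s).
Proof.
have Z0 : \sum_s weight t s != 0 by rewrite gt_eqF// sum_cw_weight_gt0.
rewrite /cw_mean cw_expectationE -[X in _ - X](mulfK Z0) -mulrBl mulrA.
congr (_ / _); rewrite mulr_sumr -sumrB /tilt mulr_suml; apply: eq_bigr => s _.
by rewrite (cw_weight_tilt x t); ring.
Qed.

Let tilt_factor_gt0 x t : 0 < expR (t * (N%:R * x)) / \sum_s weight t s.
Proof. by rewrite divr_gt0 ?expR_gt0// sum_cw_weight_gt0. Qed.

Lemma cw_mean_gt x t : (x < cw_mean t) = (0 < tilt x t).
Proof. by rewrite -subr_gt0 cw_mean_tilt pmulr_lgt0. Qed.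

Lemma cw_mean_lt x t : (cw_mean t < x) = (tilt x t < 0).
Proof. by rewrite -subr_lt0 cw_mean_tilt pmulr_llt0. Qed.

Lemma cw_mean_eq x t : cw_mean t = x <-> tilt x t = 0.
Proof.
have H := cw_mean_tilt x t; split => e.
  move: H; rewrite e subrr => /esym/eqP; rewrite mulf_eq0 => /orP[/eqP//|].
  by rewrite gt_eqF.
by move: H; rewrite e mul0r => /eqP; rewrite subr_eq0 => /eqP.
Qed.

Let expR_tilt_lt (y a b : R) : y != 0 -> a < b ->
  y * expR (a * (N%:R * y)) < y * expR (b * (N%:R * y)).
Proof.
move=> y0 ab; have Np : 0 < N%:R :> R by rewrite ltr0n.
case/orP: (lt_total y0) => ys.
  by rewrite ltr_nM2l// ltr_expR ltr_nM2r// pmulr_rlt0.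
by rewrite ltr_pM2l// ltr_expR ltr_pM2r// mulr_gt0.
Qed.

Let expR_tilt_le (y a b : R) : a <= b ->
  y * expR (a * (N%:R * y)) <= y * expR (b * (N%:R * y)).
Proof.
rewrite le_eqVlt => /predU1P[->//|ab].
have [->|y0] := eqVneq y 0; first by rewrite !mul0r.
by rewrite ltW// expR_tilt_lt.
Qed.

(** The two constant configurations have means -1 and 1, so at least one term of the sum has
    [mean s != x] and increases strictly. *)
Lemma tilt_lt x a b : a < b -> tilt x a < tilt x b.
Proof.
move=> ab.
have [s s0] : exists s, mean s - x != 0.
  have := mean_const_config R true N0; have := mean_const_config R false N0.
  rewrite /spin => e1 e2; have [x1|x1] := eqVneq x 1.
    by exists (const_config N false); rewrite e1 x1 lt_eqF//; lra.
  by exists (const_config N true); rewrite e2 subr_eq0 eq_sym.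
rewrite /tilt (bigD1 s)//= [ltRHS](bigD1 s)//= ltr_leD//.
  by rewrite ltr_pM2l ?cw_weight_gt0// expR_tilt_lt.
apply: ler_sum => i _.
by rewrite ler_pM2l ?cw_weight_gt0// expR_tilt_le// ltW.
Qed.

(** No term decreases with [t], and that of [s] grows at least linearly because [e^z >= 1 + z]. *)
Lemma tilt_ge x t s : 0 <= t -> 0 <= mean s - x ->
  tilt x 0 + weight 0 s * (t * (N%:R * (mean s - x) ^+ 2)) <= tilt x t.
Proof.
move=> t0 y0; rewrite /tilt [leRHS](bigD1 s)//= [X in X + _](bigD1 s)//= addrAC lerD//.
  rewrite mul0r expR0 mulr1 -mulrDr ler_pM2l ?cw_weight_gt0//.
  set y := mean s - x in y0 *.
  have -> : y + t * (N%:R * y ^+ 2) = y * (1 + t * (N%:R * y)) by ring.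
  by rewrite ler_wpM2l// expR_ge1Dx.
by apply: ler_sum => i _; rewrite ler_pM2l ?cw_weight_gt0// expR_tilt_le.
Qed.

Lemma tilt_le x t s : t <= 0 -> mean s - x <= 0 ->
  tilt x t <= tilt x 0 + weight 0 s * (t * (N%:R * (mean s - x) ^+ 2)).
Proof.
move=> t0 y0; rewrite /tilt [leLHS](bigD1 s)//= [X in _ <= X + _](bigD1 s)//= [leRHS]addrAC lerD//.
  rewrite mul0r expR0 mulr1 -mulrDr ler_pM2l ?cw_weight_gt0//.
  set y := mean s - x in y0 *.
  have -> : y + t * (N%:R * y ^+ 2) = y * (1 + t * (N%:R * y)) by ring.
  by rewrite ler_wnM2l// expR_ge1Dx.
by apply: ler_sum => i _; rewrite ler_pM2l ?cw_weight_gt0// expR_tilt_le.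
Qed.

Lemma continuous_tilt x : continuous (tilt x).
Proof.
move=> t; apply: (cvg_big (op := +%R)) => [|s _].
  exact: add_continuous.
apply: cvgM; first exact: cvg_cst.
apply: cvgM; first exact: cvg_cst.
have ct : u * (N%:R * (mean s - x)) @[u --> t] --> t * (N%:R * (mean s - x)).
  by apply: cvgM; [exact: cvg_id|exact: cvg_cst].
exact: (cvg_comp _ _ ct (@continuous_expR R _)).
Qed.

(** The intermediate value theorem applies to the tilted sum, whose two signs come from the linear
    bounds at the constant configurations. *)
Lemma cw_mean_surj x : -1 < x < 1 -> exists t, cw_mean t = x.
Proof.
move=> /andP[x1 x2].
have Np : 0 < N%:R :> R by rewrite ltr0n.
have [a a0 Ha] : exists2 a, 0 <= a & 0 <= tilt x a.
  pose s := const_config N true.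
  have ms : mean s = 1 by rewrite mean_const_config.
  pose D := weight 0 s * (N%:R * (mean s - x) ^+ 2).
  have D0 : 0 < D.
    by rewrite mulr_gt0 ?cw_weight_gt0// mulr_gt0// exprn_gt0// ms; lra.
  (* At this value of the field the linear term, of slope [D], compensates [tilt x 0]. *)
  have t0 : 0 <= `|tilt x 0| / D by rewrite divr_ge0// ltW.
  exists (`|tilt x 0| / D) => //.
  apply: le_trans (tilt_ge t0 (s := s) _); last by rewrite ms; lra.
  rewrite mulrCA -/D mulfVK ?gt_eqF//.
  by have := ler_norm (- tilt x 0); rewrite normrN; lra.
have [b b0 Hb] : exists2 b, b <= 0 & tilt x b <= 0.
  pose s := const_config N false.
  have ms : mean s = -1 by rewrite mean_const_config.
  pose D := weight 0 s * (N%:R * (mean s - x) ^+ 2).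
  have D0 : 0 < D.
    by rewrite mulr_gt0 ?cw_weight_gt0// mulr_gt0// exprn_even_gt0//= ms lt_eqF//; lra.
  have t0 : - (`|tilt x 0| / D) <= 0 by rewrite oppr_le0 divr_ge0// ltW.
  exists (- (`|tilt x 0| / D)) => //.
  apply: le_trans (tilt_le t0 (s := s) _) _; first by rewrite ms; lra.
  rewrite mulrCA -/D mulNr mulfVK ?gt_eqF//.
  by have := ler_norm (tilt x 0); lra.
have [||t _ t0] := @IVT R (tilt x) b a 0 (le_trans b0 a0).
- exact: continuous_subspaceT (@continuous_tilt x).
- by rewrite ge_min le_max Ha Hb orbT.
by exists t; apply/cw_mean_eq.
Qed.

(** At [x = cw_mean a] the tilted sum vanishes at [a], hence is positive at every [b > a], which
    says [cw_mean a < cw_mean b]. *)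
Lemma cw_mean_le : {mono cw_mean : a b / a <= b}.
Proof.
apply: le_mono => a b ab.
rewrite cw_mean_gt -[ltLHS]((cw_mean_eq (cw_mean a) a).1 erefl).
exact: tilt_lt.
Qed.

Lemma cw_mean_lt1 t : cw_mean t < 1.
Proof.
rewrite cw_mean_lt /tilt (bigD1 (const_config N false))//=.
rewrite -[ltRHS]addr0 ltr_leD//.
  rewrite pmulr_rlt0 ?cw_weight_gt0// pmulr_llt0 ?expR_gt0//.
  by rewrite mean_const_config// /spin; lra.
apply: sumr_le0 => s _; rewrite pmulr_rle0 ?cw_weight_gt0// pmulr_lle0 ?expR_gt0//.
by have := mean_spin_itv R s N0; lra.
Qed.

Lemma cw_mean_gtN1 t : -1 < cw_mean t.
Proof.
rewrite cw_mean_gt /tilt (bigD1 (const_config N true))//=.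
rewrite -[ltLHS]addr0 ltr_leD//.
  rewrite pmulr_rgt0 ?cw_weight_gt0// pmulr_lgt0 ?expR_gt0//.
  by rewrite mean_const_config// /spin; lra.
apply: sumr_ge0 => s _; rewrite pmulr_rge0 ?cw_weight_gt0// pmulr_lge0 ?expR_gt0//.
by have := mean_spin_itv R s N0; lra.
Qed.

(** At [mean s = 1] both sides are false and at [mean s = -1] both are true, because [cw_mean] stays
    strictly between. Elsewhere surjectivity guarantees that [xget] returns a solution of the
    likelihood equation, and strict monotonicity inverts it. *)
Lemma mle_h_le s (h r t : R) : 0 < r ->
  (r%:E * (mle_h beta p s - h%:E) <= t%:E)%E = (mean s <= cw_mean (h + t / r)).
Proof.
move=> r0; rewrite /mle_h; case: ifPn => [/eqP ->|s1].
  by rewrite /= gt0_muley ?lte_fin// leye_eq/= leNgt cw_mean_lt1.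
case: ifPn => [/eqP ->|s2].
  by rewrite /= gt0_muleNy ?lte_fin// leNye (ltW (cw_mean_gtN1 _)).
have s12 : -1 < mean s < 1.
  have /andP[m1 m2] := mean_spin_itv R s N0.
  by rewrite !lt_neqAle m1 m2 s1 eq_sym s2.
have := xgetPex 0 (cw_mean_surj s12); set h0 := xget _ _ => /= e.
rewrite -[in RHS]e cw_mean_le -EFinB -EFinM lee_fin.
by rewrite mulrC -ler_pdivlMr// lerBlDl.
Qed.

End magnetization.

(** * The limit laws *)

Section measure_with_density.
Context {R : realType} (P : probability (measurableTypeR R) R) (f : R -> R).
Local Notation mu := (@lebesgue_measure R).
Hypothesis mf : measurable_fun setT f.
Hypothesis f0 : forall x, 0 <= f x.
Hypothesis Pf : forall A, measurable A -> P A = (\int[mu]_(x in A) (f x)%:E)%E.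

Let P_dominates : P `<< mu.
Proof.
apply/null_content_dominatesP => A mA A0; rewrite Pf//.
by apply: null_set_integral => //; exact/measurable_funTS/measurable_EFinP.
Qed.

(** The Radon-Nikodym derivative of [P] agrees with [f] almost everywhere, both having the same
    integrals over measurable sets. *)
Let ge0_integral_density (g : R -> \bar R) : measurable_fun setT g ->
  (forall x, (0 <= g x)%E) ->
  (\int[P]_x g x = \int[mu]_x (g x * (f x)%:E))%E.
Proof.
move=> mg g0.
rewrite -(Radon_Nikodym_SigmaFinite.change_of_variables P_dominates)//.
have iRN := Radon_Nikodym_SigmaFinite.f_integrable P_dominates.
apply: ae_eq_integral => //.
- by apply: emeasurable_funM => //; exact: measurable_int iRN.
- by apply: emeasurable_funM => //; apply/measurable_EFinP.
- apply: ae_eqe_mul2l; apply: integral_ae_eq => //.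
    by apply/measurable_EFinP.
  move=> A _ mA.
  rewrite -(Radon_Nikodym_SigmaFinite.f_integral P_dominates)//.
  exact: Pf.
Qed.

Lemma integral_density (g : R -> R) : measurable_fun setT g ->
  (\int[P]_x g x = \int[mu]_x (f x * g x))%R.
Proof.
move=> mg; have mEg : measurable_fun setT (EFin \o g) by apply/measurable_EFinP.
rewrite /Rintegral integralE [in RHS]integralE.
rewrite !ge0_integral_density//; last 2 first.
- exact: measurable_funeneg.
- exact: measurable_funepos.
congr (fine (_ - _)); apply: eq_integral => x _.
  by rewrite !funeposE /= -!EFin_max -EFinM mulrC maxr_pMr// mulr0.
by rewrite !funenegE /= -!EFin_max -EFinM mulrC maxr_pMr// mulr0 mulrN.
Qed.

End measure_with_density.

Section quartic_law.
Variables (R : realType) (a : R).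
Hypothesis a0 : a < 0.
Local Notation mu := (@lebesgue_measure R).

(** Comparison with [e] times the indicator of an interval of length 1; it yields the positivity of
    masses and the linear growth of tilted moments. *)
Lemma Rintegral_ge_itv (f : R -> R) (x0 e : R) :
  mu.-integrable setT (EFin \o f) -> (forall x, 0 <= f x) ->
  (forall x, x0 <= x <= x0 + 1 -> e <= f x) ->
  e <= (\int[mu]_x f x)%R.
Proof.
move=> iF f0 fe.
pose D : set R := `[x0, x0 + 1]%classic.
have iD : mu.-integrable setT (EFin \o \1_D) by exact: integrable_indic_itv.
have ieD : mu.-integrable setT (EFin \o (fun x => e * \1_D x)).
  exact: (integrableZl measurableT e iD).
have <- : (\int[mu]_x (e * \1_D x))%R = e.
  rewrite RintegralZl// /Rintegral integral_indic//; last exact: measurable_itv.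
  rewrite setIT /D /= lebesgue_measure_itv /= lte_fin ltrDl ltr01 -EFinD /=.
  by rewrite addrAC subrr add0r mulr1.
apply: le_Rintegral => // x _; rewrite indicE.
have [xD|xD] := boolP (x \in D); last by rewrite mulr0.
by rewrite mulr1 fe//; move: xD; rewrite inE /D/= in_itv.
Qed.

(** The linear term of the density is moved into [g], so that all the laws [F_(0,t)] share the
    weight [quartic_fun a 0]. *)
Definition quartic_int (g : R -> R) : R :=
  (\int[mu]_x (quartic_fun a 0 x * g x))%R.

Definition quartic_mass (t : R) := quartic_int (fun x => expR (t * x)).

Definition quartic_moment (t : R) := quartic_int (fun x => x * expR (t * x)).

Definition quartic_mean (t : R) := quartic_moment t / quartic_mass t.

Definition quartic_cdf (c : R) :=
  quartic_int (fun x => (x <= c)%R%:R) / quartic_mass 0.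

Lemma measurable_expRZ (t : R) : measurable_fun setT (fun x : R => expR (t * x)).
Proof. by apply: measurableT_comp => //; exact: measurable_funM. Qed.

Lemma measurable_idM_expRZ (t : R) :
  measurable_fun setT (fun x : R => x * expR (t * x)).
Proof. by apply: measurable_funM => //; exact: measurable_expRZ. Qed.

Lemma measurable_le_cst (c : R) :
  measurable_fun setT (fun x : R => (x <= c)%R%:R : R).
Proof.
have -> : (fun x : R => (x <= c)%R%:R : R) = \1_(`]-oo, c]%classic : set R).
  by apply/funext => x; rewrite indicE mem_setE in_itv.
by apply: measurable_indic; exact: measurable_itv.
Qed.

Lemma expRZ_bound (t b x : R) : `|t| <= b -> `|expR (t * x)| <= expR (b * `|x|).
Proof.
move=> tb; rewrite ger0_norm ?expR_ge0// ler_expR (le_trans (ler_norm _))//.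
by rewrite normrM ler_wpM2r.
Qed.

Lemma idM_expRZ_bound (t b x : R) : `|t| + 1 <= b ->
  `|x * expR (t * x)| <= expR (b * `|x|).
Proof.
move=> tb; apply: (@le_trans _ _ (expR ((`|t| + 1) * `|x|))); last first.
  by rewrite ler_expR ler_wpM2r.
rewrite normrM addrC mulrDl mul1r expRD ler_pM// ?expRZ_bound//.
by apply: le_trans (expR_ge1Dx _); rewrite lerDr.
Qed.

Lemma le_cst_bound (c x : R) : `|(x <= c)%R%:R : R| <= expR (0 * `|x|).
Proof. by rewrite mul0r expR0; case: (x <= c); rewrite ?normr1// normr0. Qed.

Lemma quartic_mass_gt0 t : 0 < quartic_mass t.
Proof.
have e0 : 0 < expR (a - `|t|) by exact: expR_gt0.
apply: (lt_le_trans e0); apply: (@Rintegral_ge_itv _ 0).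
- by apply: (quartic_integrable a0 (measurable_expRZ t)) => x; exact: expRZ_bound.
- by move=> x; rewrite mulr_ge0 ?expR_ge0.
move=> x; rewrite add0r => /andP[x0 x1].
rewrite /quartic_fun -expRD ler_expR mul0r addr0 lerD//.
  rewrite -[leLHS]mulr1 ler_nM2l//; exact: exprn_ile1.
have : `|t * x| <= `|t|.
  by rewrite normrM ler_piMr// ger0_norm.
by rewrite ler_norml => /andP[].
Qed.

Lemma quartic_funE t x : quartic_fun a t x = quartic_fun a 0 x * expR (t * x).
Proof. by rewrite /quartic_fun -expRD mul0r addr0. Qed.

Let integrable_quartic t : mu.-integrable setT (EFin \o quartic_fun a t).
Proof.
have -> : quartic_fun a t = (fun x => quartic_fun a 0 x * expR (t * x)).
  by apply/funext => x; rewrite quartic_funE.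
by apply: (quartic_integrable a0 (measurable_expRZ t)) => x; exact: expRZ_bound.
Qed.

Let quartic_measureT t : quartic_measure a t setT = (quartic_mass t)%:E.
Proof.
rewrite /quartic_mass /quartic_int /Rintegral.
under [in RHS]eq_integral do rewrite -quartic_funE.
by rewrite fineK//; exact: integrable_fin_num (integrable_quartic t).
Qed.

Variable P0 : probability (measurableTypeR R) R.

(** The mass is a positive real, so [mnormalize] is a genuine division. *)
Let mnormalizeE t A :
  mnormalize (quartic_measure a t) P0 A =
  (quartic_measure a t A * ((quartic_mass t)^-1)%:E)%E.
Proof.
have q0 := quartic_mass_gt0 t.
rewrite /mnormalize [X in X == 0%E](quartic_measureT t).
rewrite [X in X == +oo%E](quartic_measureT t) [X in fine X](quartic_measureT t).
by rewrite eqe (gt_eqF q0) /=.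
Qed.

Lemma quartic_law_mean t :
  (\int[mnormalize (quartic_measure a t) P0]_u u)%R = quartic_mean t.
Proof.
pose f x := (quartic_mass t)^-1 * quartic_fun a t x.
have mf : measurable_fun setT f.
  by apply: measurable_funM => //; exact: measurable_quartic_fun.
rewrite (@integral_density R _ f) //.
- rewrite /quartic_mean /quartic_moment /quartic_int mulrC -RintegralZl//.
    by apply: eq_Rintegral => x _; rewrite /f quartic_funE; ring.
  apply: (quartic_integrable a0 (measurable_idM_expRZ t)) => x.
  exact: idM_expRZ_bound.
- by move=> x; rewrite mulr_ge0 ?expR_ge0// invr_ge0 ltW// quartic_mass_gt0.
- move=> A mA; rewrite [LHS](mnormalizeE t A) muleC /quartic_measure -integralZl//.
  by apply: (integrableS _ _ _ (integrable_quartic t)).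
Qed.

Lemma quartic_law_cdf x :
  distribution_function (mnormalize (quartic_measure a 0) P0) x = quartic_cdf x.
Proof.
rewrite /distribution_function [X in fine X](mnormalizeE 0 _) /quartic_measure.
have E : (\int[mu]_(y in `]-oo, x]%classic) (quartic_fun a 0 y)%:E =
    \int[mu]_y (quartic_fun a 0 y * (y <= x)%R%:R)%:E)%E.
  rewrite integral_mkcond; apply: eq_integral => y _.
  by rewrite /patch mem_setE in_itv/=; case: (y <= x); rewrite ?mulr1 ?mulr0.
rewrite [X in (X * _)%E]E /quartic_cdf /quartic_int /Rintegral fineM//.
apply: integrable_fin_num => //.
apply: (quartic_integrable a0 (measurable_le_cst x)) => y.
exact: le_cst_bound.
Qed.

End quartic_law.

(** * Continuity and growth in the parameter of the quartic laws *)

Section quartic_law_dependence.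
Variables (R : realType) (a : R).
Hypothesis a0 : a < 0.
Local Notation mu := (@lebesgue_measure R).
Local Notation qint := (quartic_int a).

Let mass_moment_cvg (t_ : nat -> R) (t : R) : t_ n @[n --> \oo] --> t ->
  quartic_mass a (t_ n) @[n --> \oo] --> quartic_mass a t /\
  quartic_moment a (t_ n) @[n --> \oo] --> quartic_moment a t.
Proof.
move=> ct.
have bt : \forall n \near \oo, `|t_ n| + 1 <= `|t| + 2.
  near=> n; have : `|t - t_ n| < 1 by near: n; move/cvgrPdist_lt : ct; exact.
  by have := ler_normD (t_ n - t) t; rewrite subrK distrC; lra.
have cexp w : expR (t_ n * w) @[n --> \oo] --> expR (t * w).
  have ctw : t_ n * w @[n --> \oo] --> t * w by apply: cvgM; [|exact: cvg_cst].
  exact: (cvg_comp _ _ ctw (@continuous_expR R _)).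
split.
- apply: (@quartic_integral_cvg _ _ a0 _ _ (`|t| + 2) 0) => //.
  + by move=> n; exact: measurable_expRZ.
  + exact: measurable_expRZ.
  + by apply: filterS bt => n bn u; apply: expRZ_bound; lra.
- apply: (@quartic_integral_cvg _ _ a0 _ _ (`|t| + 2) 0) => //.
  + by move=> n; exact: measurable_idM_expRZ.
  + exact: measurable_idM_expRZ.
  + by apply: filterS bt => n bn u; exact: idM_expRZ_bound.
  + by move=> w _; apply: cvgM => //; exact: cvg_cst.
Unshelve. all: by end_near. Qed.

Lemma quartic_mean_cvg (t_ : nat -> R) (t : R) : t_ n @[n --> \oo] --> t ->
  quartic_mean a (t_ n) @[n --> \oo] --> quartic_mean a t.
Proof.
move=> /mass_moment_cvg[c1 c2]; apply: cvgM => //.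
by apply: cvgV => //; rewrite gt_eqF// quartic_mass_gt0.
Qed.

(** The comparison settles once both sequences are within half of the gap [|w - c|] of their limits;
    for [w = c] it could oscillate. *)
Lemma cvg_le_indic (w c : R) (w_ c_ : nat -> R) : w != c ->
  w_ n @[n --> \oo] --> w -> c_ n @[n --> \oo] --> c ->
  ((w_ n <= c_ n)%R%:R : R) @[n --> \oo] --> ((w <= c)%R%:R : R).
Proof.
move=> wc cw cc.
suff : \forall n \near \oo, ((w <= c)%R%:R : R) = (w_ n <= c_ n)%R%:R.
  by move=> E; apply: cvg_trans (near_eq_cvg E) _; exact: cvg_cst.
pose e := `|w - c| / 2.
have e0 : 0 < e by rewrite divr_gt0// normr_gt0 subr_eq0.
near=> n.
have : `|w - w_ n| < e by near: n; move/cvgrPdist_lt : cw; exact.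
have : `|c - c_ n| < e by near: n; move/cvgrPdist_lt : cc; exact.
rewrite !ltr_norml /e => /andP[u1 u2] /andP[v1 v2].
have [wlc|clw|e'] := ltgtP w c; last by rewrite e' eqxx in wc.
  rewrite ltr0_norm ?subr_lt0// in u1 u2 v1 v2.
  by rewrite (_ : (w_ n <= c_ n) = true)//; apply: ltW; lra.
rewrite gtr0_norm ?subr_gt0// in u1 u2 v1 v2.
by rewrite (_ : (w_ n <= c_ n) = false)//; apply/negbTE; rewrite -ltNge; lra.
Unshelve. all: by end_near. Qed.

Lemma quartic_cdf_cvg (c_ : nat -> R) (c : R) : c_ n @[n --> \oo] --> c ->
  quartic_cdf a (c_ n) @[n --> \oo] --> quartic_cdf a c.
Proof.
move=> cc; apply: cvgM; last exact: cvg_cst.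
apply: (@quartic_integral_cvg _ _ a0 _ _ 0 c).
- by move=> n; exact: measurable_le_cst.
- exact: measurable_le_cst.
- by apply: nearW => n u; exact: le_cst_bound.
- by move=> w wc; apply: cvg_le_indic => //; exact: cvg_cst.
Qed.

Let integrable_exp t : mu.-integrable setT
  (EFin \o (fun x => quartic_fun a 0 x * expR (t * x))).
Proof.
by apply: (quartic_integrable a0 (measurable_expRZ t)) => x; exact: expRZ_bound.
Qed.

Let integrable_idM_exp t : mu.-integrable setT
  (EFin \o (fun x => quartic_fun a 0 x * (x * expR (t * x)))).
Proof.
apply: (quartic_integrable a0 (measurable_idM_expRZ t)) => x.
exact: idM_expRZ_bound.
Qed.

(** With [y = s x - K], the integral of [y e^(t y)] has the sign of
    [s * quartic_mean a (s * t) - K]; taking [s] to be 1 or -1 treats both directions at once. *)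
Let tilted_moment (s K t : R) :
  mu.-integrable setT (EFin \o (fun x =>
    quartic_fun a 0 x * ((s * x - K) * expR (t * (s * x - K))))) /\
  (\int[mu]_x (quartic_fun a 0 x * ((s * x - K) * expR (t * (s * x - K)))))%R =
  expR (- (t * K)) * (s * quartic_moment a (s * t) - K * quartic_mass a (s * t)).
Proof.
pose f x := s * (quartic_fun a 0 x * (x * expR (s * t * x))).
pose g x := K * (quartic_fun a 0 x * expR (s * t * x)).
have iF : mu.-integrable setT (EFin \o f).
  exact: (integrableZl measurableT s (integrable_idM_exp (s * t))).
have iG : mu.-integrable setT (EFin \o g).
  exact: (integrableZl measurableT K (integrable_exp (s * t))).
have iFG : mu.-integrable setT (EFin \o (fun x => f x - g x)).
  by have := integrableB measurableT iF iG.
have -> : (fun x => quartic_fun a 0 x * ((s * x - K) * expR (t * (s * x - K)))) =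
    (fun x => expR (- (t * K)) * (f x - g x)).
  apply/funext => x; rewrite /f /g.
  have -> : expR (t * (s * x - K)) = expR (- (t * K)) * expR (s * t * x).
    by rewrite -expRD; congr expR; ring.
  by ring.
split; first exact: (integrableZl measurableT (expR (- (t * K))) iFG).
rewrite RintegralZl//; congr (_ * _).
by rewrite RintegralB// /f /g RintegralZl ?RintegralZl//.
Qed.

(** For either sign, [s x - K] runs over [[1, 2]] on the unit interval centred at [s (K + 3/2)]. *)
Let sign_interval (s K x : R) : s = 1 \/ s = -1 ->
  s * (K + 3 / 2) - 1 / 2 <= x <= s * (K + 3 / 2) - 1 / 2 + 1 ->
  1 <= s * x - K <= 2.
Proof. by case=> ->; lra. Qed.

Let sign_bound (K z : R) : 1 <= z - K -> z - K <= 2 -> `|z| <= `|K| + 2.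
Proof.
by have := ler_norm K; have := ler_norm (- K); rewrite normrN ler_norml; lra.
Qed.

Let convex_tilt (t y : R) : 0 <= t -> 1 <= y -> y + t <= y * expR (t * y).
Proof.
move=> t0 y1; have : y * (1 + t * y) <= y * expR (t * y).
  by rewrite ler_pM2l ?expR_ge1Dx//; lra.
have : t * 1 <= t * (y * y) by rewrite ler_wpM2l// mulr_ege1.
by move: (expR _) => e; nra.
Qed.

(* With [y = s x - K], convexity gives [y e^(t y) >= y + t] where [1 <= y] and
   [y e^(t y) >= y] elsewhere, so [E[y e^(t y)]] is positive for large [t]. *)
Lemma quartic_mean_unbounded (s K : R) : s * s = 1 ->
  exists T : R, forall t, T <= t -> K <= s * quartic_mean a (s * t).
Proof.
move=> ss.
have s1 : s = 1 \/ s = -1.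
  by move/eqP: ss; rewrite -expr2 sqrf_eq1 => /orP[]/eqP; [left|right].
have as1 : `|s| = 1 by case: s1 => ->; rewrite ?normrN normr1.
(* Where [1 <= y <= 2] one has [|x| <= b], so the weight is at least [d] there. The integral at [t]
   exceeds its value [J0] at 0 by at least [t d], and [t >= |J0| / d] makes it nonnegative. *)
pose b := `|K| + 2; pose d := expR (a * b ^+ 4).
have d0 : 0 < d by exact: expR_gt0.
pose J0 := s * quartic_moment a (s * 0) - K * quartic_mass a (s * 0).
exists (`|J0| / d) => t tT.
have t0 : 0 <= t by apply: le_trans tT; rewrite divr_ge0// ltW.
have [it et] := tilted_moment s K t; have [i0 e0] := tilted_moment s K 0.
have H : t * d <= (\int[mu]_x (
    quartic_fun a 0 x * ((s * x - K) * expR (t * (s * x - K))) -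
    quartic_fun a 0 x * ((s * x - K) * expR (0 * (s * x - K)))))%R.
  apply: (@Rintegral_ge_itv _ _ (s * (K + 3 / 2) - 1 / 2)).
  - by have := integrableB measurableT it i0.
  - move=> x; rewrite -mulrBr mulr_ge0 ?expR_ge0// mul0r expR0 mulr1.
    move: (s * x - K) => y; rewrite subr_ge0.
    have [y0|y0] := leP 0 y.
      by rewrite ler_peMr// -[leLHS]expR0 ler_expR mulr_ge0.
    by rewrite ler_niMr ?(ltW y0)// expR_le1 mulr_ge0_le0// ltW.
  - move=> x x01; rewrite -mulrBr mul0r expR0 mulr1 mulrC.
    have /andP[y1 y2] := sign_interval s1 x01.
    have xb : `|x| <= b.
      have -> : `|x| = `|s * x| by rewrite normrM as1 mul1r.
      exact: sign_bound.
    apply: ler_pM => //; first exact: ltW.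
      rewrite /quartic_fun mul0r addr0 ler_expR ler_nM2l//.
      rewrite -[leLHS]ger0_norm ?exprn_even_ge0// normrX lerXn2r ?nnegrE//.
      by rewrite /b addr_ge0.
    by rewrite lerBrDl convex_tilt.
move: H; rewrite RintegralB// et e0 (mul0r K) oppr0 expR0 mul1r -/J0 lerBrDr => H.
have : 0 <= expR (- (t * K)) *
    (s * quartic_moment a (s * t) - K * quartic_mass a (s * t)).
  apply: le_trans H; rewrite -lerBlDr sub0r (le_trans (ler_norm _))// normrN.
  by rewrite -ler_pdivrMr.
rewrite pmulr_rge0 ?expR_gt0// subr_ge0 /quartic_mean mulrA.
by rewrite ler_pdivlMr// quartic_mass_gt0.
Qed.

End quartic_law_dependence.

(** * Fluctuations *)

Section fluctuations.
Variables (R : realType) (beta h : R) (p : nat) (m : R).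
Hypothesis p3 : (3 <= p)%N.
Hypothesis hm : unique_global_maximizer beta h p m.
Hypothesis m1 : -1 < m < 1.
Hypothesis H2 : H_deriv beta h p 2 m = 0.
Local Notation a := (quartic_coef beta h p m).
Local Notation lsum := (laplace_sum beta h p m).

Lemma quartic_coef_lt0 : a < 0.
Proof. by have := H_deriv4_max p3 hm m1 H2; rewrite /quartic_coef; lra. Qed.

Definition fluct N (s : config N) : R := rho R N * (mean_spin R s - m).

Lemma sum_cw_weight_fluct N (g : R -> R) : (0 < N)%N ->
  \sum_(s : config N) cw_weight beta h p s * g (fluct s) =
  2 ^+ N / stirling_ratio R N * expR (N%:R * H_fun beta h p m) *
    binom_ratio R N (idx m N 0) * lsum N g.
Proof.
move=> N0; rewrite /fluct /cw_weight.
rewrite (sum_config (fun x => expR (N%:R * (beta * x ^+ p + h * x)) *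
  g (rho R N * (x - m))) N0) /laplace_sum mulr_sumr.
apply: eq_bigr => k _; rewrite mulrA binom_weightE//; last by rewrite -ltnS.
rewrite /laplace_weight /scaled.
have r0 : binom_ratio R N (idx m N 0) != 0 by rewrite gt_eqF// binom_ratio_gt0.
move: (H_fun beta h p (mean_of R N k)) (H_fun beta h p m) (g _) => y z gw.
have e0 : expR (N%:R * z) != 0 by rewrite gt_eqF// expR_gt0.
rewrite (mulrBr _ y z) expRD expRN.
move: (stirling_ratio R N)^-1 (binom_ratio R N k) (binom_ratio _ _ _) r0 => u b c c0.
move: (expR (N%:R * y)) (expR _) e0 => v w w0.
by field; rewrite c0 w0.
Qed.

Let norm_const_neq0 N : 2 ^+ N / stirling_ratio R N *
  expR (N%:R * H_fun beta h p m) * binom_ratio R N (idx m N 0) != 0.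
Proof.
rewrite gt_eqF// mulr_gt0 ?binom_ratio_gt0// mulr_gt0 ?expR_gt0//.
by rewrite divr_gt0 ?exprn_gt0// stirling_ratio_gt0.
Qed.

(** As [N = rho^4], adding [t / rho^3] to the field multiplies the weight by
    [e^(t rho mean) = e^(t W) e^(t rho m)]; the last factor is constant and cancels. This is the
    origin of the scale [N^(3/4)]. *)
Lemma fluct_mean_tilt N (t : R) : (0 < N)%N ->
  rho R N * (cw_mean beta p N (h + t / rho R N ^+ 3) - m) =
  lsum N (fun w => w * expR (t * w)) / lsum N (fun w => expR (t * w)).
Proof.
move=> N0; have r0 := rho_gt0 R N0.
have rn0 : rho R N != 0 by rewrite gt_eqF.
have W (s : config N) : cw_weight beta (h + t / rho R N ^+ 3) p s =
    cw_weight beta h p s * expR (t * fluct s) * expR (t * (rho R N * m)).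
  rewrite /cw_weight -!expRD; congr expR; rewrite /fluct -(rhoX4 R N).
  by field.
have c0 : expR (t * (rho R N * m)) != 0 by rewrite gt_eqF// expR_gt0.
have E1 : \sum_(s : config N) cw_weight beta (h + t / rho R N ^+ 3) p s =
    expR (t * (rho R N * m)) *
    \sum_(s : config N) cw_weight beta h p s * expR (t * fluct s).
  by rewrite mulr_sumr; apply: eq_bigr => s _; rewrite W mulrC.
have E2 : rho R N * (cw_mean beta p N (h + t / rho R N ^+ 3) - m) =
    (\sum_(s : config N) cw_weight beta h p s * (fluct s * expR (t * fluct s))) /
    \sum_(s : config N) cw_weight beta h p s * expR (t * fluct s).
  have Z0 := sum_cw_weight_gt0 beta p N (h + t / rho R N ^+ 3).
  rewrite /cw_mean cw_expectationE -[X in _ - X](mulfK (lt0r_neq0 Z0)) -mulrBl.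
  rewrite mulrA E1 -[RHS]mul1r -(divff c0) mulf_div -E1; congr (_ / _).
  rewrite E1 !mulr_sumr -sumrB mulr_sumr; apply: eq_bigr => s _.
  by rewrite W /fluct; ring.
rewrite E2 (sum_cw_weight_fluct (fun w => w * expR (t * w)) N0).
rewrite (sum_cw_weight_fluct (fun w => expR (t * w)) N0).
by rewrite -mulf_div divff ?mul1r.
Qed.

Lemma cw_prob_fluct_le N (c : R) : (0 < N)%N ->
  cw_prob beta h p (fun s : config N => fluct s <= c) =
  lsum N (fun w => (w <= c)%R%:R) / lsum N (fun w => expR (0 * w)).
Proof.
move=> N0; rewrite cw_probE//.
rewrite (sum_cw_weight_fluct (fun w => (w <= c)%R%:R) N0).
(* The total weight is put in the form of a tilted mass at [t = 0]. *)
have -> : \sum_(s : config N) cw_weight beta h p s =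
    \sum_(s : config N) cw_weight beta h p s * expR (0 * fluct s).
  by apply: eq_bigr => s _; rewrite mul0r expR0 mulr1.
rewrite (sum_cw_weight_fluct (fun w => expR (0 * w)) N0).
by rewrite -mulf_div divff ?mul1r.
Qed.

Let laplace_ratio_cvg (u_ v_ : nat -> R) (u v : R) : v != 0 ->
  mesh R N * u_ N @[N --> \oo] --> u -> mesh R N * v_ N @[N --> \oo] --> v ->
  u_ N / v_ N @[N --> \oo] --> u / v.
Proof.
move=> v0 cu cv.
have : (mesh R N * u_ N) / (mesh R N * v_ N) @[N --> \oo] --> u / v.
  by apply: cvgM => //; exact: cvgV.
apply: cvg_trans; apply: near_eq_cvg; near=> N.
rewrite -mulf_div divff ?mul1r// gt_eqF// divr_gt0// exprn_gt0// rho_gt0//.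
by near: N; exact: nbhs_infty_gt.
Unshelve. all: by end_near. Qed.

Let laplace_mass_cvg (t : R) :
  mesh R N * lsum N (fun w => expR (t * w)) @[N --> \oo] --> quartic_mass a t.
Proof.
apply: (@laplace_sum_cvg _ _ _ _ _ p3 hm m1 H2 _ _ `|t| 0).
- exact: measurable_expRZ.
- by move=> N u; exact: expRZ_bound.
move=> w u_ _ cu.
have ct : t * u_ N @[N --> \oo] --> t * w by apply: cvgM => //; exact: cvg_cst.
exact: (cvg_comp _ _ ct (@continuous_expR R _)).
Qed.

Lemma fluct_mean_cvg (t : R) :
  rho R N * (cw_mean beta p N (h + t / rho R N ^+ 3) - m) @[N --> \oo] -->
  quartic_mean a t.
Proof.
have v0 : quartic_mass a t != 0.
  by rewrite gt_eqF// quartic_mass_gt0// quartic_coef_lt0.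
have cu : mesh R N * lsum N (fun w => w * expR (t * w)) @[N --> \oo] -->
    quartic_moment a t.
  apply: (@laplace_sum_cvg _ _ _ _ _ p3 hm m1 H2 _ _ (`|t| + 1) 0).
  - exact: measurable_idM_expRZ.
  - by move=> N u; exact: idM_expRZ_bound.
  move=> w u_ _ cu; apply: cvgM => //.
  have ct : t * u_ N @[N --> \oo] --> t * w by apply: cvgM => //; exact: cvg_cst.
  exact: (cvg_comp _ _ ct (@continuous_expR R _)).
have := laplace_ratio_cvg v0 cu (@laplace_mass_cvg t).
apply: cvg_trans; apply: near_eq_cvg; near=> N.
by rewrite fluct_mean_tilt//; near: N; exact: nbhs_infty_gt.
Unshelve. all: by end_near. Qed.

(** The threshold moves with [N], because it will be the rescaled mean under the perturbed field;
    the exceptional point of the integrand is its limit [c]. *)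
Lemma fluct_cdf_cvg (c_ : nat -> R) (c : R) : c_ N @[N --> \oo] --> c ->
  cw_prob beta h p (fun s : config N => fluct s <= c_ N) @[N --> \oo] -->
  quartic_cdf a c.
Proof.
move=> cc.
have v0 : quartic_mass a 0 != 0.
  by rewrite gt_eqF// quartic_mass_gt0// quartic_coef_lt0.
have cu : mesh R N * lsum N (fun w => (w <= c_ N)%R%:R) @[N --> \oo] -->
    quartic_int a (fun w => (w <= c)%R%:R).
  apply: (@laplace_sum_cvg _ _ _ _ _ p3 hm m1 H2
    (fun N w => (w <= c_ N)%R%:R) _ 0 c).
  - exact: measurable_le_cst.
  - by move=> N u; exact: le_cst_bound.
  - by move=> w u_ wc cu; exact: cvg_le_indic.
have := laplace_ratio_cvg v0 cu (@laplace_mass_cvg 0).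
apply: cvg_trans; apply: near_eq_cvg; near=> N.
by rewrite cw_prob_fluct_le//; near: N; exact: nbhs_infty_gt.
Unshelve. all: by end_near. Qed.

(** A limit of functions increasing in [t], the rescaled means of the finite models; no derivative
    of the mean has to be computed as a variance. *)
Lemma quartic_mean_nondecreasing :
  {homo quartic_mean a : t u / t <= u}.
Proof.
move=> t u tu; apply: ler_cvg_to (@fluct_mean_cvg t) (@fluct_mean_cvg u) _.
near=> N; have N0 : (0 < N)%N by near: N; exact: nbhs_infty_gt.
rewrite ler_pM2l ?rho_gt0// lerD2r cw_mean_le// lerD2l ler_pM2r//.
by rewrite invr_gt0 exprn_gt0// rho_gt0.
Unshelve. all: by end_near. Qed.

Lemma mle_cdf_cvg (t : R) :
  cw_prob beta h p (fun s : config N =>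
    ((N%:R `^ (3 / 4))%:E * (mle_h beta p s - h%:E) <= t%:E)%E)
    @[N --> \oo] --> quartic_cdf a (quartic_mean a t).
Proof.
have := fluct_cdf_cvg (@fluct_mean_cvg t).
apply: cvg_trans; apply: near_eq_cvg; near=> N.
have N0 : (0 < N)%N by near: N; exact: nbhs_infty_gt.
rewrite /cw_prob; apply: eq_bigl => s.
rewrite -rhoX3 mle_h_le//; last by rewrite exprn_gt0// rho_gt0.
by rewrite /fluct ler_pM2l ?rho_gt0// lerD2r.
Unshelve. all: by end_near. Qed.

End fluctuations.

(** * Distribution functions and the existence of the limit law *)

Lemma probability_of_cdf (R : realType) (F : R -> R) :
  nondecreasing_fun F -> right_continuous F ->
  F x @[x --> -oo] --> (0 : R) -> F x @[x --> +oo] --> (1 : R) ->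
  exists P : probability (measurableTypeR R) R,
    forall x, distribution_function P x = F x.
Proof.
move=> ndF rcF F0 F1.
(* The Lebesgue-Stieltjes measure of [F], whose limits 0 and 1 make it a probability. *)
pose G : cumulativeBounded (0 : R) (1 : R) := HB.pack F
  (isCumulative.Build R _ _ F ndF rcF) (isCumulativeBounded.Build R 0 1 F F0 F1).
exists (lebesgue_stieltjes_measure G) => x.
have := cdf_lebesgue_stieltjes_id G x.
by rewrite /cdf /distribution /pushforward preimage_id /distribution_function => ->.
Qed.

Section distribution_function_limits.
Variables (R : realType) (P : probability (measurableTypeR R) R).
Local Notation F := (distribution_function P).

Lemma distribution_function_nondecreasing : nondecreasing_fun F.
Proof.
move=> x y xy; rewrite /distribution_function fine_le ?fin_num_measure//.
apply: le_measure; rewrite ?inE; [exact: measurable_itv..|].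
by apply: subset_itvl; rewrite bnd_simp.
Qed.

Lemma cvg_distribution_function :
  (F x @[x --> +oo] --> (1 : R)) /\ (F x @[x --> -oo] --> (0 : R)).
Proof.
(* The identity as a random variable under [P]: its law is [P] itself, so the limits of [cdf]
   apply. *)
pose X : {RV P >-> R} := HB.pack (idfun : measurableTypeR R -> R)
  (isMeasurableFun.Build _ _ (measurableTypeR R) R idfun (@measurable_id _ _ setT)).
have FX : F = fine \o cdf X by [].
by split; rewrite FX; apply: fine_cvg; [exact: cvg_cdfy1|exact: cvg_cdfNy0].
Qed.

End distribution_function_limits.

Theorem theorem2p2 (R : realType) (p : nat) (beta h m : R)
  (hp : (3 <= p)%N)
  (hbeta : 0 <= beta)
  (hspecial : p_special beta h p)
  (hm : unique_global_maximizer beta h p m) :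
  exists G1 : probability (measurableTypeR R) R,
    (forall t : R,
       distribution_function G1 t =
       distribution_function (F_law beta h p m 0 0)
         (\int[F_law beta h p m 0 t]_u u)) /\
    cw_cvg_distribution beta h p
      (fun (N : nat) (s : config N) =>
         ((N%:R `^ (3 / 4))%:E * (mle_h beta p s - h%:E))%E)
      G1.
Proof.
have [m' [[hm' _] m1 H2']] := hspecial.
have mm : m' = m by case: hm => _; apply.
rewrite {}mm {hm'} in m1 H2'.
have H2 : H_deriv beta h p 2 m = 0 by rewrite -derive1n_H.
pose a := quartic_coef beta h p m.
have a0 : a < 0 by exact: quartic_coef_lt0.
have lawE t : F_law beta h p m 0 t =
    mnormalize (quartic_measure a t) (dirac (0 : measurableTypeR R)).
  have ea : (H_fun beta h p)^`(4)%classic m / 24 = a.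
    by apply: (congr1 (fun x => x / 24)); exact: derive1n_H.
  have eb : 0 * p%:R * m ^+ p.-1 + t = t by rewrite !mul0r add0r.
  exact: (congr2 (fun x y => mnormalize (quartic_measure x y)
    (dirac (0 : measurableTypeR R)) : probability _ _) ea eb).
have cdfE x : distribution_function (F_law beta h p m 0 0) x = quartic_cdf a x.
  by rewrite lawE quartic_law_cdf.
have meanE t : (\int[F_law beta h p m 0 t]_u u)%R = quartic_mean a t.
  by rewrite lawE quartic_law_mean.
pose F t := quartic_cdf a (quartic_mean a t).
have cdf_nd : nondecreasing_fun (quartic_cdf a).
  move=> x y xy; rewrite -!cdfE; exact: distribution_function_nondecreasing.
have [cdf1 cdf0] : quartic_cdf a x @[x --> +oo] --> (1 : R) /\
    quartic_cdf a x @[x --> -oo] --> (0 : R).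
  have -> : quartic_cdf a = distribution_function (F_law beta h p m 0 0).
    by apply/funext => x; rewrite cdfE.
  exact: cvg_distribution_function.
have mean_nd := quartic_mean_nondecreasing hp hm m1 H2.
have meany : quartic_mean a t @[t --> +oo] --> +oo.
  apply/cvgryPge => K.
  have [T HT] := quartic_mean_unbounded a0 K (mulr1 1).
  near=> t; have := HT t; rewrite !mul1r; apply; near: t.
  by apply: nbhs_pinfty_ge; exact: num_real.
have meanNy : quartic_mean a t @[t --> -oo] --> -oo.
  apply/cvgrNyPle => K.
  (* The case [s = -1] at level [- K], read at [- t]. *)
  have [T HT] := quartic_mean_unbounded a0 (- K) (etrans (mulrNN 1 1) (mulr1 1)).
  near=> t; have := HT (- t); rewrite !mulN1r opprK lerN2; apply.
  by rewrite lerNr; near: t; apply: nbhs_ninfty_le; exact: num_real.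
(* Monotonicity and continuity of the mean and of the limiting distribution function pass to the
   composition [F]; the unboundedness of the mean in both directions gives the limits 0 and 1. *)
have [||||G1 G1E] := @probability_of_cdf R F.
- by move=> x y xy; apply/cdf_nd/mean_nd.
- move=> t; apply/cvg_at_rightP => u [_ ut].
  exact/quartic_cdf_cvg/quartic_mean_cvg.
- exact: cvg_comp meanNy cdf0.
- exact: cvg_comp meany cdf1.
exists G1; split; first by move=> t; rewrite G1E meanE cdfE.
by move=> t _; rewrite G1E; exact: mle_cdf_cvg.
Unshelve. all: by end_near. Qed.
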